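(* Fix a sign $\pm\in\{+,-\}$. Let $R>\hat R:=16\,e^{(2e)^{-1}}$ and $T>0$. Then there exists a number $\hat C>0$ such that for all pairs of functions $(y^0,y^1),(\widetilde y^0,\widetilde y^1)\in(\mathcal R_{R,\hat C})^2$ which are even with respect to $0$, there exist functions $y\in G^{1,2}([0,1]\times[0,T])$ and $v,w\in G^2([0,T])$ satisfying $$\partial_t^2y=\pm\partial_x^4y+\partial_x^2y-\partial_x^2(y^2),\quad x\in[0,1],\ t\in[0,T],$$ $$\partial_xy(0,t)=0,\quad \partial_xy(1,t)=v(t),\quad \partial_x^3y(0,t)=0,\quad \partial_x^3y(1,t)=w(t),\quad t\in[0,T],$$ $$y(x,0)=y^0(x),\quad \partial_ty(x,0)=y^1(x),\quad x\in[0,1],$$ together with $y(x,T)=\widetilde y^0(x)$ and $\partial_ty(x,T)=\widetilde y^1(x)$ for all $x\in[0,1]$.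
   Context: All functions are real-valued. $\mathcal R_{R,C}$ ($R>1$, $C>0$): functions $z$ on $[-1,1]$ for which there is a sequence $(\alpha_n)_{n\ge0}$ with $|\alpha_n|\le C\,n!/R^n$ for all $n$ and $z(x)=\sum_{n\ge0}\alpha_nx^n/n!$ for all $x\in[-1,1]$. Gevrey classes: $h\in G^s([t_1,t_2])$ if $h\in C^\infty$ and $|h^{(p)}(t)|\le C(p!)^s/R^p$ for some $C,R>0$ and all $p\in\mathbb N$, $t\in[t_1,t_2]$. $y\in G^{s_1,s_2}([x_1,x_2]\times[t_1,t_2])$ if $y\in C^\infty$ and $|\partial_x^{p_1}\partial_t^{p_2}y(x,t)|\le C(p_1!)^{s_1}(p_2!)^{s_2}/(R_1^{p_1}R_2^{p_2})$ for some $C,R_1,R_2>0$, all $(x,t)$ and all $p_1,p_2\in\mathbb N$. *)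

(* Defs.v *)
From Stdlib Require Import Reals Lra Factorial.
From Coquelicot Require Import Coquelicot.
Open Scope R_scope.

(* Functions on an interval [a, b] (or a rectangle) are represented by total
   functions on R (or R * R), of which only the values on [a, b] are ever used.
   Hence all derivatives are derivatives relative to the closed interval, i.e.
   one-sided at its end points. *)

Definition is_derive_on (a b : R) (f : R -> R) (x l : R) : Prop :=
  filterdiff f (within (fun z : R => a <= z <= b) (locally x))
    (fun h : R => scal h l).

Definition ex_derive_on (a b : R) (f : R -> R) (x : R) : Prop :=
  exists l : R, is_derive_on a b f x l.

(* Meaningful only where [ex_derive_on a b f x] holds, for [a < b] and [x] in
   [a, b]; see [Derive_on_unique]. *)
Definition Derive_on (a b : R) (f : R -> R) (x : R) : R :=
  iota (is_derive_on a b f x).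

Fixpoint Derive_n_on (a b : R) (f : R -> R) (n : nat) : R -> R :=
  match n with
  | O => f
  | S m => Derive_on a b (Derive_n_on a b f m)
  end.

Lemma is_derive_on_spec (a b : R) (f : R -> R) (x l : R) (hx : a <= x <= b) :
  is_derive_on a b f x l <->
  forall eps : posreal, locally x (fun z : R => a <= z <= b ->
    Rabs (f z - f x - (z - x) * l) <= eps * Rabs (z - x)).
Proof.
split.
- intros [_ H]; exact (H x (fun P HP =>
    filter_imp _ _ (fun z Hz _ => Hz) HP)).
- intros H; split; [exact (is_linear_scal_l l) |].
  intros x' Hx'.
  assert (E : x' = x).
  { apply eq_close; intros eps.
    pose proof (Hx' _ (locally_ball x' eps)) as H'.
    apply locally_singleton in H'; exact (H' hx). }
  subst x'; exact H.
Qed.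

Lemma Derive_on_unique (a b : R) (f : R -> R) (x l : R) (hab : a < b)
  (hx : a <= x <= b) (hl : is_derive_on a b f x l) : Derive_on a b f x = l.
Proof.
apply (iota_unique (V := R_CompleteNormedModule)); [| exact hl].
intros m hm.
pose proof (proj1 (is_derive_on_spec a b f x _ hx) hl) as hl'.
pose proof (proj1 (is_derive_on_spec a b f x _ hx) hm) as hm'.
destruct (Req_dec m l) as [E | N]; [exact E | exfalso].
assert (he : 0 < Rabs (m - l) / 4).
{ apply Rdiv_lt_0_compat; [apply Rabs_pos_lt; lra | lra]. }
destruct (filter_and _ _ (hl' (mkposreal _ he)) (hm' (mkposreal _ he)))
  as [d Hd].
assert (Hz : exists z, a <= z <= b /\ z <> x /\ Rabs (z - x) < d).
{ pose proof (cond_pos d) as hd.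
  destruct (Rlt_dec x b) as [hb | hb].
  - exists (x + Rmin (d / 2) (b - x)).
    assert (0 < Rmin (d / 2) (b - x)) by (apply Rmin_pos; lra).
    pose proof (Rmin_l (d / 2) (b - x)); pose proof (Rmin_r (d / 2) (b - x)).
    repeat split; try lra; rewrite Rabs_pos_eq; lra.
  - exists (x - Rmin (d / 2) (x - a)).
    assert (0 < Rmin (d / 2) (x - a)) by (apply Rmin_pos; lra).
    pose proof (Rmin_l (d / 2) (x - a)); pose proof (Rmin_r (d / 2) (x - a)).
    repeat split; try lra; rewrite Rabs_left; lra. }
destruct Hz as [z [hz [hzx hzd]]].
destruct (Hd z hzd) as [H1 H2]; specialize (H1 hz); specialize (H2 hz).
simpl in H1, H2.
assert (H : Rabs ((z - x) * (m - l)) <=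
  Rabs (f z - f x - (z - x) * l) + Rabs (f z - f x - (z - x) * m)).
{ replace ((z - x) * (m - l)) with
    ((f z - f x - (z - x) * l) + - (f z - f x - (z - x) * m)) by ring.
  rewrite <- (Rabs_Ropp (f z - f x - (z - x) * m)); apply Rabs_triang. }
rewrite Rabs_mult in H.
assert (0 < Rabs (z - x)) by (apply Rabs_pos_lt; lra).
nra.
Qed.

Definition smooth_on (t1 t2 : R) (h : R -> R) : Prop :=
  forall (p : nat) (t : R), t1 <= t <= t2 ->
    ex_derive_on t1 t2 (Derive_n_on t1 t2 h p) t.

Definition Gevrey (s t1 t2 : R) (h : R -> R) : Prop :=
  smooth_on t1 t2 h /\
  exists C r : R, 0 < C /\ 0 < r /\
    forall (p : nat) (t : R), t1 <= t <= t2 ->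
      Rabs (Derive_n_on t1 t2 h p t) <= C * Rpower (INR (fact p)) s / r ^ p.

Definition Dx_n (x1 x2 : R) (p : nat) (y : R -> R -> R) : R -> R -> R :=
  fun x t => Derive_n_on x1 x2 (fun x' => y x' t) p x.

Definition Dt_n (t1 t2 : R) (p : nat) (y : R -> R -> R) : R -> R -> R :=
  fun x t => Derive_n_on t1 t2 (fun t' => y x t') p t.

Fixpoint C_n_on2 (x1 x2 t1 t2 : R) (n : nat) (y : R -> R -> R) : Prop :=
  continuous_on (fun q : R * R => x1 <= fst q <= x2 /\ t1 <= snd q <= t2)
    (fun q : R * R => y (fst q) (snd q)) /\
  match n with
  | O => True
  | S m =>
      (forall x t : R, x1 <= x <= x2 -> t1 <= t <= t2 ->
        ex_derive_on x1 x2 (fun x' => y x' t) x /\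
        ex_derive_on t1 t2 (fun t' => y x t') t) /\
      C_n_on2 x1 x2 t1 t2 m (Dx_n x1 x2 1 y) /\
      C_n_on2 x1 x2 t1 t2 m (Dt_n t1 t2 1 y)
  end.

Definition smooth_on2 (x1 x2 t1 t2 : R) (y : R -> R -> R) : Prop :=
  forall n : nat, C_n_on2 x1 x2 t1 t2 n y.

Definition Gevrey2 (s1 s2 x1 x2 t1 t2 : R) (y : R -> R -> R) : Prop :=
  smooth_on2 x1 x2 t1 t2 y /\
  exists C R1 R2 : R, 0 < C /\ 0 < R1 /\ 0 < R2 /\
    forall (p1 p2 : nat) (x t : R), x1 <= x <= x2 -> t1 <= t <= t2 ->
      Rabs (Dx_n x1 x2 p1 (Dt_n t1 t2 p2 y) x t) <=
        C * Rpower (INR (fact p1)) s1 * Rpower (INR (fact p2)) s2 /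
          (R1 ^ p1 * R2 ^ p2).

Definition class_R (rho C : R) (z : R -> R) : Prop :=
  exists alpha : nat -> R,
    (forall n : nat, Rabs (alpha n) <= C * INR (fact n) / rho ^ n) /\
    (forall x, -1 <= x <= 1 ->
      is_pseries (fun n => alpha n / INR (fact n)) x (z x)).

Definition even_on_unit (z : R -> R) : Prop :=
  forall x : R, -1 <= x <= 1 -> z (- x) = z x.

Definition R_hat : R := 16 * exp (/ (2 * exp 1)).

(* Main.v *)
Require Import Defs.
From Stdlib Require Import Reals Lra Lia Factorial Wf_nat.
From Coquelicot Require Import Coquelicot.
Open Scope R_scope.

(** The equation is solved in the space variable, starting from [x = 0]. An even
    solution has a Taylor series [y = \sum a_n(t) x^n / n!] in which [a_0] and
    [a_2] are free functions of time, all odd [a_n] vanish, and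
    [a_(n+4)] is determined by [a_n''], [a_(n+2)] and the Taylor coefficient of
    order [n + 2] of [y^2] ([space_jet]). The boundary controls are then just
    the values of [y_x] and [y_xxx] at [x = 1]. So the theorem reduces to the
    choice of [a_0] and [a_2] such that the series converges on [[0, 1]] and
    takes the prescribed data at both ends of the time interval.

    Two time derivatives are worth four space derivatives, so the natural
    estimate for the derivative of order [n] in [x] and [p] in [t] at a point is
    a multiple of [(n + 2 p)! / (s^n r^p)]. These bounds are reproduced by
    products up to one more factorial ([leibniz_bound]: after division by the
    factorials the Leibniz formula becomes a sum of beta integrals). As the
    nonlinear term is of order two lower than the leading ones, it is absorbed
    when the solution is small, and the bounds propagate along the equation,
    from time to space ([space_jet_bound]) and from space to time
    ([time_jet_bound]).

    In the second direction the data at [t = 0] determine all time derivatives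
    of [y] and [y_xx] at [(0, 0)], of size about [(2 p)! / 50^p]; likewise at [t = T].
    It remains to find [a_0] and [a_2] with these jets at [0] and at [T], and
    with derivatives of size [(2 p)! / (3/2)^p]; the loss from [50] to [3/2] is
    what the large lower bound on the radius [rho] of the data has to cover.
    The formal Taylor series at [0] diverges in general. It is summed, as in
    the Borel-Laplace method, after replacing [t^p] by the truncated Laplace
    transform [1 / p! * \int_0^12 u^p exp(-u/t)/t du] ([truncmono]), which has
    the same jet at [0]. All derivatives of these functions are explicit in terms
    of the kernels [exp(-s/t)/t^j] ([flatker]), whose derivatives involve
    Laguerre polynomials; this gives [borel_gevrey]. A cutoff built from
    [exp(-12/t)] and [exp(-12/(T-t))] then separates the two ends
    ([gevrey_jet_two_ends]).

    Since both recursions express the same equation, the solution built from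
    these [a_0] and [a_2] has the prescribed data at [t = 0] and [t = T]
    ([space_jet_time_jet]).

    A smooth function on an interval is handled through the sequence of its
    one-sided derivatives ([tower]); series of such functions are differentiated
    by summing Taylor remainders ([is_derive_on_Series]). *)

(** * Binomial sums and factorials *)

Notation facR n := (INR (fact n)).

Lemma facR_pos n : 0 < facR n.
Proof. apply lt_0_INR, lt_O_fact. Qed.

Lemma facR_neq n : facR n <> 0.
Proof. apply INR_fact_neq_0. Qed.

Lemma facR_S n : facR (S n) = (INR n + 1) * facR n.
Proof. rewrite fact_simpl, mult_INR, S_INR; reflexivity. Qed.

Lemma facR_ge_1 n : 1 <= facR n.
Proof. apply (le_INR 1); pose proof (lt_O_fact n); lia. Qed.

(** [binsum n h] is the sum over [k <= n] of [C(n, k) * h k (n - k)]. Pascal's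
    recursion is taken as the definition since it is also the step of the
    Leibniz rule: [h k l] stands for a product of a [k]-th and an [l]-th
    derivative. *)
Fixpoint binsum (n : nat) (h : nat -> nat -> R) : R :=
  match n with
  | O => h O O
  | S m => binsum m (fun k l => h (S k) l) + binsum m (fun k l => h k (S l))
  end.

Lemma binsum_ext n : forall h g,
  (forall k l, (k + l = n)%nat -> h k l = g k l) -> binsum n h = binsum n g.
Proof.
induction n as [|n IH]; intros h g H; simpl.
- apply H; lia.
- f_equal; apply IH; intros k l E; apply H; lia.
Qed.

Lemma binsum_le n : forall h g,
  (forall k l, (k + l = n)%nat -> h k l <= g k l) -> binsum n h <= binsum n g.
Proof.
induction n as [|n IH]; intros h g H; simpl.
- apply H; lia.
- apply Rplus_le_compat; apply IH; intros k l E; apply H; lia.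
Qed.

Lemma binsum_scal n : forall c h,
  binsum n (fun k l => c * h k l) = c * binsum n h.
Proof.
induction n as [|n IH]; intros c h; simpl; [reflexivity|].
rewrite (IH c (fun k l => h (S k) l)), (IH c (fun k l => h k (S l))); ring.
Qed.

Lemma binsum_plus n : forall h g,
  binsum n (fun k l => h k l + g k l) = binsum n h + binsum n g.
Proof.
induction n as [|n IH]; intros h g; simpl; [reflexivity|].
rewrite (IH (fun k l => h (S k) l)), (IH (fun k l => h k (S l))); ring.
Qed.

Lemma binsum_Rabs n : forall h g,
  (forall k l, (k + l = n)%nat -> Rabs (h k l) <= g k l) ->
  Rabs (binsum n h) <= binsum n g.
Proof.
induction n as [|n IH]; intros h g H; simpl.
- apply H; lia.
- eapply Rle_trans; [apply Rabs_triang|].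
  apply Rplus_le_compat; apply IH; intros k l E; apply H; lia.
Qed.

Lemma binsum_zero n h :
  (forall k l, (k + l = n)%nat -> h k l = 0) -> binsum n h = 0.
Proof.
intros H; rewrite (binsum_ext n h (fun _ _ => 0 * 0)).
- rewrite binsum_scal; ring.
- intros k l E; rewrite H by exact E; ring.
Qed.

Lemma binsum_left n : forall h,
  (forall k l, h (S k) l = 0) -> binsum n h = h O n.
Proof.
induction n as [|n IH]; intros h H; simpl; [reflexivity|].
rewrite (binsum_zero n (fun k l => h (S k) l)) by (intros; apply H).
rewrite IH by (intros; apply H); ring.
Qed.

(** The Euler integral of [x ^ j * (1 - x) ^ i] for [x] from [0] to [1]. *)
Definition beta (j i : nat) : R := facR j * facR i / facR (j + i + 1).

Lemma beta_pos j i : 0 < beta j i.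
Proof.
apply Rdiv_lt_0_compat; [apply Rmult_lt_0_compat|]; apply facR_pos.
Qed.

Lemma beta_split j i : beta (S j) i + beta j (S i) = beta j i.
Proof.
unfold beta.
replace (S j + i + 1)%nat with (S (j + i + 1)) by lia.
replace (j + S i + 1)%nat with (S (j + i + 1)) by lia.
rewrite !facR_S, !plus_INR; simpl (INR 1).
pose proof (facR_neq (j + i + 1)); pose proof (pos_INR j); pose proof (pos_INR i).
field; split; [assumption | lra].
Qed.

(** The integrands [x ^ (j + k) * (1 - x) ^ (i + l)] add up, with binomial
    weights, to [x ^ j * (1 - x) ^ i * (x + (1 - x)) ^ m]. *)
Lemma binsum_beta m : forall j i,
  binsum m (fun k l => beta (j + k) (i + l)) = beta j i.
Proof.
induction m as [|m IH]; intros j i; simpl.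
- rewrite !Nat.add_0_r; reflexivity.
- rewrite <- beta_split, <- (IH (S j) i), <- (IH j (S i)).
  f_equal; apply binsum_ext; intros k l _; f_equal; lia.
Qed.

(** Here the factor is [(x ^ 2 + (1 - x) ^ 2) ^ p <= 1]. *)
Lemma binsum_beta_double p : forall j i,
  binsum p (fun k l => beta (j + 2 * k) (i + 2 * l)) <= beta j i.
Proof.
induction p as [|p IH]; intros j i; simpl.
- rewrite !Nat.add_0_r; lra.
- apply Rle_trans with (beta (S (S j)) i + beta j (S (S i))).
  + apply Rplus_le_compat.
    * eapply Rle_trans; [|exact (IH (S (S j)) i)]; right.
      apply binsum_ext; intros k l _; f_equal; lia.
    * eapply Rle_trans; [|exact (IH j (S (S i)))]; right.
      apply binsum_ext; intros k l _; f_equal; lia.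
  + pose proof (beta_split j i); pose proof (beta_split (S j) i).
    pose proof (beta_split j (S i)); pose proof (beta_pos (S j) (S i)); lra.
Qed.

(** A product of two functions whose derivatives of order [k] in [x] and [q]
    in [t] grow like [(k + 2 q)!] obeys the same bound with one factorial more.
    One [t]-derivative counts for two [x]-derivatives, so the bound depends on
    the total weight only, and after division by [(m + 2 p + 1)!] the
    factorials of the Leibniz sum become beta integrals. *)
Lemma leibniz_bound (u v : nat -> nat -> R) (A B x r : R) (m p : nat) :
  0 < x -> 0 < r ->
  (forall k q, (k <= m)%nat -> (q <= p)%nat ->
    Rabs (u k q) <= A * facR (k + 2 * q) / (x ^ k * r ^ q)) ->
  (forall k q, (k <= m)%nat -> (q <= p)%nat ->
    Rabs (v k q) <= B * facR (k + 2 * q) / (x ^ k * r ^ q)) ->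
  Rabs (binsum m (fun k l => binsum p (fun q q' => u k q * v l q'))) <=
    A * B * facR (m + 2 * p + 1) / (x ^ m * r ^ p).
Proof.
intros hx hr Hu Hv.
pose proof (pow_lt x) as Px; pose proof (pow_lt r) as Pr.
assert (HA : 0 <= A).
{ generalize (Hu O O ltac:(lia) ltac:(lia)); simpl; intros H.
  pose proof (Rabs_pos (u O O)); lra. }
assert (HB : 0 <= B).
{ generalize (Hv O O ltac:(lia) ltac:(lia)); simpl; intros H.
  pose proof (Rabs_pos (v O O)); lra. }
set (K := A * B * facR (m + 2 * p + 1) / (x ^ m * r ^ p)).
assert (HK : 0 <= K).
{ unfold K, Rdiv; apply Rmult_le_pos.
  - apply Rmult_le_pos; [apply Rmult_le_pos; assumption | left; apply facR_pos].
  - left; apply Rinv_0_lt_compat, Rmult_lt_0_compat; auto. }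
apply Rle_trans with (binsum m (fun k l => K * beta (0 + k) (0 + l))).
2:{ rewrite binsum_scal, binsum_beta; unfold beta; simpl; lra. }
apply binsum_Rabs; intros k l Ekl.
apply Rle_trans with (K * binsum p (fun q q' => beta (k + 2 * q) (l + 2 * q'))).
2:{ apply Rmult_le_compat_l; [exact HK | apply binsum_beta_double]. }
rewrite <- binsum_scal.
apply binsum_Rabs; intros q q' Eq.
rewrite Rabs_mult.
eapply Rle_trans.
- apply Rmult_le_compat; try apply Rabs_pos; [apply Hu | apply Hv]; lia.
- right; unfold K, beta.
  replace (k + 2 * q + (l + 2 * q') + 1)%nat with (m + 2 * p + 1)%nat by lia.
  subst m p; rewrite !pow_add.
  pose proof (facR_neq (k + l + 2 * (q + q') + 1)).
  pose proof (Px k hx); pose proof (Px l hx); pose proof (Pr q hr); pose proof (Pr q' hr).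
  field; repeat split; lra.
Qed.

(** A single term of the binomial expansion of [(x + y) ^ (n + k) = 1]. *)
Lemma binomial_term_le (x y : R) : 0 <= x -> 0 <= y -> x + y = 1 ->
  forall n k : nat, facR (n + k) * x ^ n * y ^ k <= facR n * facR k.
Proof.
intros hx hy hxy.
assert (H : forall N n k, (n + k = N)%nat ->
  facR (n + k) * x ^ n * y ^ k <= facR n * facR k).
2:{ intros n k; apply (H (n + k)%nat); reflexivity. }
assert (P1 : forall z n, 0 <= z -> z <= 1 -> z ^ n <= 1).
{ intros z n h0 h1; rewrite <- (pow1 n); apply pow_incr; lra. }
induction N as [|N IH]; intros n k E.
- replace n with O by lia; replace k with O by lia; simpl; lra.
- destruct n as [|n]; [|destruct k as [|k]].
  + simpl; pose proof (P1 y k hy ltac:(lra)); pose proof (facR_pos k).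
    rewrite Rmult_1_r, Rmult_1_l; rewrite <- (Rmult_1_r (facR k)) at 2.
    apply Rmult_le_compat_l; lra.
  + rewrite Nat.add_0_r, pow_O, Rmult_1_r.
    pose proof (P1 x (S n) hx ltac:(lra)); pose proof (facR_pos (S n)).
    apply Rmult_le_compat_l; [lra | simpl in *; lra].
  + pose proof (IH n (S k) ltac:(lia)) as H1.
    pose proof (IH (S n) k ltac:(lia)) as H2.
    replace (S n + S k)%nat with (S (n + S k)) by lia.
    replace (S n + k)%nat with (n + S k)%nat in H2 by lia.
    rewrite (facR_S (n + S k)), plus_INR, S_INR.
    rewrite (facR_S n), (facR_S k) in *.
    simpl pow in *.
    pose proof (pos_INR n); pose proof (pos_INR k).
    apply (Rmult_le_compat_l (x * (INR n + 1))) in H1; [|nra].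
    apply (Rmult_le_compat_l (y * (INR k + 1))) in H2; [|nra].
    replace ((INR n + 1) * facR n * ((INR k + 1) * facR k)) with
      (x * (INR n + 1) * (facR n * ((INR k + 1) * facR k)) +
       y * (INR k + 1) * ((INR n + 1) * facR n * facR k)).
    2:{ replace x with (1 - y) by lra; ring. }
    eapply Rle_trans; [|apply Rplus_le_compat; [exact H1 | exact H2]].
    right; ring.
Qed.

(** The coefficients of a product of power series, in terms of derivatives at
    the origin. *)
Lemma binsum_sum_f_R0 (n : nat) : forall h,
  binsum n h =
  facR n * sum_f_R0 (fun k => h k (n - k)%nat / (facR k * facR (n - k))) n.
Proof.
induction n as [|n IH]; intros h.
- simpl; field.
- simpl binsum; rewrite (IH (fun k l => h (S k) l)), (IH (fun k l => h k (S l))).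
  rewrite facR_S, <- Rmult_plus_distr_l, Rmult_comm, (Rmult_comm (INR n + 1)).
  rewrite Rmult_assoc, Rmult_comm; f_equal.
  set (g := fun k => h k (S n - k)%nat / (facR k * facR (S n - k))).
  assert (E : (INR n + 1) * sum_f_R0 g (S n) =
    sum_f_R0 (fun k => INR k * g k) (S n) +
    sum_f_R0 (fun k => INR (S n - k) * g k) (S n)).
  { rewrite <- sum_plus, scal_sum; apply sum_eq; intros k Hk.
    rewrite minus_INR, S_INR by exact Hk; ring. }
  rewrite E; f_equal.
  + rewrite (decomp_sum _ (S n)) by lia; simpl pred; simpl (INR 0).
    rewrite Rmult_0_l, Rplus_0_l; apply sum_eq; intros k Hk; unfold g.
    replace (S n - S k)%nat with (n - k)%nat by lia.
    rewrite facR_S, S_INR; pose proof (pos_INR k).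
    pose proof (facR_neq k); pose proof (facR_neq (n - k)).
    field; repeat split; try assumption; lra.
  + rewrite tech5, Nat.sub_diag; simpl (INR 0).
    rewrite Rmult_0_l, Rplus_0_r; apply sum_eq; intros k Hk; unfold g.
    replace (S n - k)%nat with (S (n - k)) by lia.
    rewrite facR_S, S_INR; pose proof (pos_INR (n - k)).
    pose proof (facR_neq k); pose proof (facR_neq (n - k)).
    field; repeat split; try assumption; lra.
Qed.

Lemma PS_mult_binsum (a b : nat -> R) (n : nat) :
  PS_mult (fun k => a k / facR k) (fun k => b k / facR k) n =
  binsum n (fun k l => a k * b l) / facR n.
Proof.
rewrite binsum_sum_f_R0; unfold PS_mult.
pose proof (facR_neq n); field_simplify; [|assumption].
rewrite (sum_eq _ (fun k => a k * b (n - k)%nat / (facR k * facR (n - k)))).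
- field; assumption.
- intros k _; pose proof (facR_neq k); pose proof (facR_neq (n - k)).
  field; split; assumption.
Qed.

(** * Towers of one-sided derivatives *)

(** Continuing [f] outside [[a, b]] by its tangent at [x] turns a derivative
    relative to [[a, b]] into an ordinary one, so that the rules of
    differentiation carry over. *)
Lemma is_derive_on_iff (a b : R) (f : R -> R) (x l : R) (hx : a <= x <= b) :
  is_derive_on a b f x l <->
  exists g : R -> R, is_derive g x l /\ forall z, a <= z <= b -> g z = f z.
Proof.
rewrite is_derive_on_spec by exact hx; split.
- intros H.
  set (g := fun z => if Rle_dec a z then if Rle_dec z b then f z
    else f x + (z - x) * l else f x + (z - x) * l).
  assert (Hg : forall z, a <= z <= b -> g z = f z).
  { intros z hz; unfold g; destruct (Rle_dec a z); [|lra].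
    destruct (Rle_dec z b); lra. }
  exists g; split; [|exact Hg].
  split; [exact (is_linear_scal_l l)|].
  intros x' Hx' eps.
  assert (E : x' = x).
  { symmetry; apply is_filter_lim_locally_unique; exact Hx'. }
  subst x'.
  destruct (H eps) as [d Hd]; exists d; intros z Hz.
  specialize (Hd z Hz).
  change (Rabs (g z - g x - (z - x) * l) <= eps * Rabs (z - x)).
  rewrite (Hg x hx).
  assert (D : a <= z <= b \/ ~ (a <= z <= b)) by lra.
  destruct D as [D|D].
  + rewrite (Hg z D); exact (Hd D).
  + replace (g z) with (f x + (z - x) * l).
    * replace (f x + (z - x) * l - f x - (z - x) * l) with 0 by ring.
      rewrite Rabs_R0; apply Rmult_le_pos; [left; apply cond_pos | apply Rabs_pos].
    * unfold g; destruct (Rle_dec a z); [|reflexivity].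
      destruct (Rle_dec z b); [lra|reflexivity].
- intros [g [[_ Hg] E]] eps.
  destruct (Hg x (fun P HP => HP) eps) as [d Hd].
  exists d; intros z Hz hz; rewrite <- (E z hz), <- (E x hx); exact (Hd z Hz).
Qed.

Lemma is_derive_on_is_derive (a b : R) (f : R -> R) (x l : R) :
  a <= x <= b -> is_derive f x l -> is_derive_on a b f x l.
Proof.
intros hx H; apply is_derive_on_iff; [exact hx|].
exists f; split; [exact H | reflexivity].
Qed.

Lemma is_derive_on_ext (a b : R) (f g : R -> R) (x l : R) :
  a <= x <= b -> (forall z, a <= z <= b -> f z = g z) ->
  is_derive_on a b f x l -> is_derive_on a b g x l.
Proof.
intros hx E H; apply is_derive_on_iff in H; [|exact hx].
destruct H as [h [H Eh]]; apply is_derive_on_iff; [exact hx|].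
exists h; split; [exact H | intros z hz; rewrite Eh, E; auto].
Qed.

Lemma is_derive_on_plus (a b : R) (f g : R -> R) (x l m : R) :
  a <= x <= b -> is_derive_on a b f x l -> is_derive_on a b g x m ->
  is_derive_on a b (fun z => f z + g z) x (l + m).
Proof.
intros hx Hf Hg.
apply is_derive_on_iff in Hf; apply is_derive_on_iff in Hg; try exact hx.
destruct Hf as [f1 [Hf Ef]]; destruct Hg as [g1 [Hg Eg]].
apply is_derive_on_iff; [exact hx|].
exists (fun z => f1 z + g1 z); split.
- apply (is_derive_plus f1 g1); assumption.
- intros z hz; rewrite Ef, Eg; auto.
Qed.

Lemma is_derive_mult_R (f g : R -> R) (x l m : R) :
  is_derive f x l -> is_derive g x m ->
  is_derive (fun z => f z * g z) x (l * g x + f x * m).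
Proof.
intros Hf Hg; apply (is_derive_mult f g); try assumption.
intros; apply Rmult_comm.
Qed.

Lemma is_derive_on_mult (a b : R) (f g : R -> R) (x l m : R) :
  a <= x <= b -> is_derive_on a b f x l -> is_derive_on a b g x m ->
  is_derive_on a b (fun z => f z * g z) x (l * g x + f x * m).
Proof.
intros hx Hf Hg.
apply is_derive_on_iff in Hf; apply is_derive_on_iff in Hg; try exact hx.
destruct Hf as [f1 [Hf Ef]]; destruct Hg as [g1 [Hg Eg]].
apply is_derive_on_iff; [exact hx|].
exists (fun z => f1 z * g1 z); split.
- rewrite <- (Ef x hx), <- (Eg x hx).
  apply is_derive_mult_R; assumption.
- intros z hz; rewrite Ef, Eg; auto.
Qed.

Lemma is_derive_on_scal (a b c : R) (f : R -> R) (x l : R) :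
  a <= x <= b -> is_derive_on a b f x l ->
  is_derive_on a b (fun z => c * f z) x (c * l).
Proof.
intros hx Hf; apply is_derive_on_iff in Hf; [|exact hx].
destruct Hf as [f1 [Hf Ef]]; apply is_derive_on_iff; [exact hx|].
exists (fun z => c * f1 z); split.
- apply is_derive_scal; assumption.
- intros z hz; rewrite Ef; auto.
Qed.

Lemma is_derive_on_reflect (T : R) (f : R -> R) (t l : R) :
  0 <= t <= T -> is_derive_on 0 T f (T - t) l ->
  is_derive_on 0 T (fun z => f (T - z)) t (- l).
Proof.
intros ht Hf; apply is_derive_on_iff in Hf; [|lra].
destruct Hf as [f1 [Hf Ef]]; apply is_derive_on_iff; [exact ht|].
exists (fun z => f1 (T - z)); split.
- replace (- l) with (scal (-1) l) by (unfold scal; simpl; unfold mult; simpl; ring).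
  apply (is_derive_comp f1 (fun z => T - z)); [exact Hf|].
  auto_derive; [trivial | ring].
- intros z hz; apply Ef; lra.
Qed.

(** Composition with the projection onto [[a, b]] makes continuity one-sided, as
    the mean value theorem for functions on the line requires. *)
Definition clamp (a b z : R) : R := Rmax a (Rmin b z).

Lemma clamp_in (a b z : R) : a <= b -> a <= clamp a b z <= b.
Proof.
intros h; unfold clamp, Rmax, Rmin.
destruct (Rle_dec b z), (Rle_dec _ _); lra.
Qed.

Lemma clamp_id (a b z : R) : a <= z <= b -> clamp a b z = z.
Proof.
intros h; unfold clamp, Rmax, Rmin.
destruct (Rle_dec b z), (Rle_dec _ _); lra.
Qed.

Lemma clamp_close (a b x z : R) :
  a <= x <= b -> Rabs (clamp a b z - x) <= Rabs (z - x).
Proof.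
intros h; unfold clamp, Rmax, Rmin.
destruct (Rle_dec b z), (Rle_dec _ _); unfold Rabs;
  repeat destruct Rcase_abs; lra.
Qed.

Lemma is_derive_on_continuous (a b : R) (f : R -> R) (x l : R) :
  a <= x <= b -> is_derive_on a b f x l ->
  continuity_pt (fun z => f (clamp a b z)) x.
Proof.
intros hx H; apply is_derive_on_iff in H; [|exact hx].
destruct H as [g [Hg Eg]].
assert (Cg : continuity_pt g x).
{ apply continuity_pt_filterlim, (ex_derive_continuous g); exists l; exact Hg. }
intros eps he; destruct (Cg eps he) as [d [hd Hd]]; exists d; split; [exact hd|].
intros z [_ Hz]; simpl in *; unfold Rdist in *.
rewrite (clamp_id a b x hx), <- (Eg x hx), <- Eg by (apply clamp_in; lra).
destruct (Req_dec (clamp a b z) x) as [E|N].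
- rewrite E, Rminus_diag, Rabs_R0; exact he.
- apply Hd; split.
  + split; [exact I | auto].
  + eapply Rle_lt_trans; [apply clamp_close; exact hx | exact Hz].
Qed.

Lemma is_derive_on_interior (a b : R) (f : R -> R) (x l : R) :
  a < x < b -> is_derive_on a b f x l -> is_derive f x l.
Proof.
intros hx H; apply is_derive_on_iff in H; [|lra].
destruct H as [g [Hg Eg]]; apply (is_derive_ext_loc g); [|exact Hg].
assert (hd : 0 < Rmin (x - a) (b - x)) by (apply Rmin_pos; lra).
exists (mkposreal _ hd); intros z Hz; apply Eg.
assert (Hz' : Rabs (z - x) < Rmin (x - a) (b - x)) by exact Hz.
pose proof (Rmin_l (x - a) (b - x)); pose proof (Rmin_r (x - a) (b - x)).
apply Rabs_def2 in Hz'; lra.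
Qed.

Lemma MVT_on (a b : R) (f df : R -> R) (x z : R) :
  a <= x <= b -> a <= z <= b ->
  (forall u, a <= u <= b -> is_derive_on a b f u (df u)) ->
  exists c, a <= c <= b /\ f z - f x = df c * (z - x).
Proof.
intros hx hz H.
assert (B : forall u, Rmin x z <= u <= Rmax x z -> a <= u <= b).
{ intros u; unfold Rmin, Rmax; destruct (Rle_dec x z); lra. }
destruct (MVT_gen (fun u => f (clamp a b u)) x z df) as [c [Hc E]].
- intros u Hu; pose proof (B u ltac:(lra)) as Bu.
  assert (hu : a < u < b).
  { revert Hu; unfold Rmin, Rmax; destruct (Rle_dec x z); lra. }
  apply (is_derive_ext_loc f).
  + assert (hd : 0 < Rmin (u - a) (b - u)) by (apply Rmin_pos; lra).
    exists (mkposreal _ hd); intros v Hv.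
    assert (Hv' : Rabs (v - u) < Rmin (u - a) (b - u)) by exact Hv.
    pose proof (Rmin_l (u - a) (b - u)); pose proof (Rmin_r (u - a) (b - u)).
    apply Rabs_def2 in Hv'; rewrite clamp_id; [reflexivity | lra].
  + apply (is_derive_on_interior a b); auto.
- intros u Hu; apply (is_derive_on_continuous a b f u (df u)); auto.
- exists c; split; [apply B; exact Hc|].
  rewrite !clamp_id in E by assumption; exact E.
Qed.

Lemma lipschitz_on (a b M : R) (f df : R -> R) (x z : R) :
  a <= x <= b -> a <= z <= b ->
  (forall u, a <= u <= b -> is_derive_on a b f u (df u)) ->
  (forall u, a <= u <= b -> Rabs (df u) <= M) ->
  Rabs (f z - f x) <= M * Rabs (z - x).
Proof.
intros hx hz H B; destruct (MVT_on a b f df x z hx hz H) as [c [hc E]].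
rewrite E, Rabs_mult; apply Rmult_le_compat_r; [apply Rabs_pos | auto].
Qed.

Lemma taylor_on (a b M : R) (f df ddf : R -> R) (x z : R) :
  a <= x <= b -> a <= z <= b ->
  (forall u, a <= u <= b -> is_derive_on a b f u (df u)) ->
  (forall u, a <= u <= b -> is_derive_on a b df u (ddf u)) ->
  (forall u, a <= u <= b -> Rabs (ddf u) <= M) ->
  Rabs (f z - f x - (z - x) * df x) <= M * (z - x) ^ 2.
Proof.
intros hx hz H1 H2 B.
assert (B' : forall u, Rmin x z <= u <= Rmax x z -> a <= u <= b).
{ intros u; unfold Rmin, Rmax; destruct (Rle_dec x z); lra. }
assert (hM : 0 <= M).
{ eapply Rle_trans; [apply Rabs_pos | apply (B x hx)]. }
(* The intermediate point has to lie between [x] and [z], hence the smaller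
   interval. *)
destruct (MVT_on (Rmin x z) (Rmax x z) f df x z) as [c [hc E]].
- split; [apply Rmin_l | apply Rmax_l].
- split; [apply Rmin_r | apply Rmax_r].
- intros u hu; specialize (H1 u (B' u hu)).
  apply is_derive_on_iff in H1; [|auto]; destruct H1 as [g [Hg Eg]].
  apply is_derive_on_iff; [exact hu|]; exists g; split; auto.
- rewrite E.
  replace (df c * (z - x) - (z - x) * df x) with ((df c - df x) * (z - x)) by ring.
  rewrite Rabs_mult.
  pose proof (lipschitz_on a b M df ddf x c hx (B' c hc) H2 B) as HL.
  assert (Hc : Rabs (c - x) <= Rabs (z - x)).
  { revert hc; unfold Rmin, Rmax; destruct (Rle_dec x z);
    unfold Rabs; repeat destruct Rcase_abs; lra. }
  replace ((z - x) ^ 2) with (Rabs (z - x) * Rabs (z - x)).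
  2:{ rewrite <- Rabs_mult, Rabs_pos_eq; [ring | apply Rle_0_sqr]. }
  rewrite <- Rmult_assoc; apply Rmult_le_compat_r; [apply Rabs_pos|].
  eapply Rle_trans; [exact HL|]; apply Rmult_le_compat_l; assumption.
Qed.

(** A smooth function on [[a, b]] comes with all its derivatives, so that sums,
    products and series can be differentiated to all orders by giving the
    formula for the derivative of order [q]. *)
Definition tower (a b : R) (f : nat -> R -> R) : Prop :=
  forall q t, a <= t <= b -> is_derive_on a b (f q) t (f (S q) t).

Lemma tower_ext (a b : R) (f g : nat -> R -> R) :
  (forall q t, a <= t <= b -> f q t = g q t) -> tower a b f -> tower a b g.
Proof.
intros E H q t ht; rewrite <- (E (S q) t ht).
apply (is_derive_on_ext a b (f q)); auto.
Qed.

Lemma Derive_on_ext (a b : R) (f g : R -> R) (x l : R) :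
  a < b -> a <= x <= b -> (forall z, a <= z <= b -> f z = g z) ->
  is_derive_on a b g x l -> Derive_on a b f x = l.
Proof.
intros hab hx E H; apply Derive_on_unique; try assumption.
apply (is_derive_on_ext a b g); auto; intros; symmetry; auto.
Qed.

Lemma tower_Derive_n_on (a b : R) (f : nat -> R -> R) (h : R -> R) :
  a < b -> tower a b f -> (forall t, a <= t <= b -> h t = f O t) ->
  forall q t, a <= t <= b -> Derive_n_on a b h q t = f q t.
Proof.
intros hab H E; induction q as [|q IH]; intros t ht; simpl; [auto|].
apply (Derive_on_ext a b _ (f q)); auto.
Qed.

Lemma tower_smooth_on (a b : R) (f : nat -> R -> R) (h : R -> R) :
  a < b -> tower a b f -> (forall t, a <= t <= b -> h t = f O t) ->
  smooth_on a b h.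
Proof.
intros hab H E p t ht; exists (f (S p) t).
apply (is_derive_on_ext a b (f p)); auto.
intros z hz; symmetry; apply (tower_Derive_n_on a b f); auto.
Qed.

Lemma tower_shift (a b : R) (f : nat -> R -> R) (k : nat) :
  tower a b f -> tower a b (fun q => f (q + k)%nat).
Proof. intros H q t ht; apply (H (q + k)%nat t ht). Qed.

Lemma tower_plus (a b : R) (f g : nat -> R -> R) :
  tower a b f -> tower a b g -> tower a b (fun q t => f q t + g q t).
Proof. intros Hf Hg q t ht; apply is_derive_on_plus; auto. Qed.

Lemma tower_scal (a b c : R) (f : nat -> R -> R) :
  tower a b f -> tower a b (fun q t => c * f q t).
Proof. intros Hf q t ht; apply is_derive_on_scal; auto. Qed.

Lemma is_derive_on_binsum (a b : R) (h dh : nat -> nat -> R -> R) (n : nat) (t : R) :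
  a <= t <= b ->
  (forall k l, is_derive_on a b (h k l) t (dh k l t)) ->
  is_derive_on a b (fun z => binsum n (fun k l => h k l z)) t
    (binsum n (fun k l => dh k l t)).
Proof.
intros ht; revert h dh; induction n as [|n IH]; intros h dh H; simpl.
- apply H.
- apply is_derive_on_plus; [exact ht| |].
  + apply (IH (fun k l => h (S k) l) (fun k l => dh (S k) l)); auto.
  + apply (IH (fun k l => h k (S l)) (fun k l => dh k (S l))); auto.
Qed.

Lemma tower_binsum (a b : R) (h : nat -> nat -> nat -> R -> R) (n : nat) :
  (forall k l, tower a b (h k l)) ->
  tower a b (fun q t => binsum n (fun k l => h k l q t)).
Proof.
intros H q t ht.
apply (is_derive_on_binsum a b (fun k l => h k l q) (fun k l => h k l (S q))); auto.
intros k l; apply H; exact ht.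
Qed.

Lemma tower_mult (a b : R) (f g : nat -> R -> R) :
  tower a b f -> tower a b g ->
  tower a b (fun q t => binsum q (fun k l => f k t * g l t)).
Proof.
intros Hf Hg q t ht; simpl; rewrite <- binsum_plus.
apply (is_derive_on_binsum a b (fun k l z => f k z * g l z)
  (fun k l z => f (S k) z * g l z + f k z * g (S l) z)); auto.
intros k l; apply is_derive_on_mult; auto.
Qed.

Lemma tower_reflect (T : R) (f : nat -> R -> R) :
  tower 0 T f -> tower 0 T (fun q t => (-1) ^ q * f q (T - t)).
Proof.
intros Hf q t ht.
replace ((-1) ^ S q * f (S q) (T - t)) with ((-1) ^ q * - f (S q) (T - t))
  by (simpl; ring).
apply is_derive_on_scal; [exact ht|].
apply is_derive_on_reflect; [exact ht | apply Hf; lra].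
Qed.

(** * Termwise differentiation *)

Lemma ex_series_bounded (u M : nat -> R) :
  (forall n, Rabs (u n) <= M n) -> ex_series M -> ex_series u.
Proof.
intros H HM; apply (ex_series_le (V := R_CompleteNormedModule) u M); assumption.
Qed.

Lemma Series_bounded (u M : nat -> R) :
  (forall n, Rabs (u n) <= M n) -> ex_series M -> Rabs (Series u) <= Series M.
Proof.
intros H HM; eapply Rle_trans; [apply Series_Rabs|].
- apply (ex_series_bounded _ M); [intros n; rewrite Rabs_Rabsolu; auto | exact HM].
- apply Series_le; [intros n; split; [apply Rabs_pos | auto] | exact HM].
Qed.

(** A bound on the second derivatives controls the Taylor remainders uniformly,
    and these can be summed. *)
Lemma is_derive_on_Series (a b : R) (f df ddf : nat -> R -> R)
  (M0 M1 M2 : nat -> R) :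
  (forall n t, a <= t <= b -> is_derive_on a b (f n) t (df n t)) ->
  (forall n t, a <= t <= b -> is_derive_on a b (df n) t (ddf n t)) ->
  (forall n t, a <= t <= b -> Rabs (f n t) <= M0 n) -> ex_series M0 ->
  (forall n t, a <= t <= b -> Rabs (df n t) <= M1 n) -> ex_series M1 ->
  (forall n t, a <= t <= b -> Rabs (ddf n t) <= M2 n) -> ex_series M2 ->
  forall t, a <= t <= b ->
  is_derive_on a b (fun z => Series (fun n => f n z)) t
    (Series (fun n => df n t)).
Proof.
intros D1 D2 B0 S0 B1 S1 B2 S2 t ht.
assert (X0 : forall z, a <= z <= b -> ex_series (fun n => f n z)).
{ intros z hz; apply (ex_series_bounded _ M0); auto. }
assert (X1 : ex_series (fun n => df n t)).
{ apply (ex_series_bounded _ M1); auto. }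
apply is_derive_on_spec; [exact ht|]; intros eps.
set (M := Series M2).
assert (hM : 0 <= M).
{ eapply Rle_trans; [apply Rabs_pos|].
  apply (Series_bounded (fun n => ddf n t)); auto. }
assert (hd : 0 < eps / (M + 1)).
{ apply Rdiv_lt_0_compat; [apply cond_pos | lra]. }
exists (mkposreal _ hd); intros z Hz hz.
assert (Hz' : Rabs (z - t) < eps / (M + 1)) by exact Hz.
apply Rle_trans with (M * (z - t) ^ 2).
- rewrite <- Series_minus, <- Series_scal_l, <- Series_minus; auto.
  + rewrite (Rmult_comm M); unfold M; rewrite <- Series_scal_l.
    apply (Series_bounded _ (fun n => (z - t) ^ 2 * M2 n)).
    * intros n; rewrite (Rmult_comm _ (M2 n)).
      apply (taylor_on a b (M2 n) (f n) (df n) (ddf n)); auto.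
    * apply (ex_series_scal_l (K := R_AbsRing) ((z - t) ^ 2) M2); exact S2.
  + apply (ex_series_minus (K := R_AbsRing) (V := R_NormedModule)); auto.
  + apply (ex_series_scal_l (K := R_AbsRing) (z - t) (fun n => df n t)); exact X1.
- replace ((z - t) ^ 2) with (Rabs (z - t) * Rabs (z - t)).
  2:{ rewrite <- Rabs_mult, Rabs_pos_eq; [ring | apply Rle_0_sqr]. }
  rewrite <- Rmult_assoc; apply Rmult_le_compat_r; [apply Rabs_pos|].
  apply Rle_trans with ((M + 1) * Rabs (z - t)).
  + apply Rmult_le_compat_r; [apply Rabs_pos | lra].
  + apply Rmult_lt_compat_l with (r := M + 1) in Hz'; [|lra].
    replace ((M + 1) * (eps / (M + 1))) with (pos eps) in Hz' by (field; lra).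
    lra.
Qed.

Lemma tower_Series (a b : R) (f : nat -> nat -> R -> R) (M : nat -> nat -> R) :
  (forall n, tower a b (f n)) ->
  (forall n q t, a <= t <= b -> Rabs (f n q t) <= M q n) ->
  (forall q, ex_series (M q)) ->
  tower a b (fun q t => Series (fun n => f n q t)).
Proof.
intros Hf HB HM q t ht.
apply (is_derive_on_Series a b (fun n => f n q) (fun n => f n (S q))
  (fun n => f n (S (S q))) (M q) (M (S q)) (M (S (S q)))); auto;
intros n z hz; apply Hf; exact hz.
Qed.

(** * The flat kernels exp(-s/t)/t^j *)

Lemma pow_le_exp (y : R) (m : nat) : 0 <= y -> y ^ m <= facR m * exp y.
Proof.
intros hy; pose proof (exp_ge_taylor y m hy) as H.
assert (H1 : y ^ m / facR m <= exp y).
{ eapply Rle_trans; [|exact H]; destruct m as [|m]; [simpl; lra|].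
  rewrite tech5; assert (0 <= sum_f_R0 (fun k => y ^ k / facR k) m); [|lra].
  apply cond_pos_sum; intros k; apply Rmult_le_pos; [apply pow_le; exact hy|].
  left; apply Rinv_0_lt_compat, facR_pos. }
apply (Rmult_le_compat_l (facR m)) in H1; [|left; apply facR_pos].
replace (facR m * (y ^ m / facR m)) with (y ^ m) in H1; [exact H1|].
field; apply facR_neq.
Qed.

Lemma pow_mult_exp_le (x : R) (m : nat) :
  0 <= x -> x ^ m * exp (- (x / 2)) <= facR m * 2 ^ m.
Proof.
intros hx; pose proof (pow_le_exp (x / 2) m ltac:(lra)) as H.
replace (x ^ m) with ((x / 2) ^ m * 2 ^ m).
2:{ rewrite <- Rpow_mult_distr; f_equal; field. }
apply Rle_trans with (facR m * exp (x / 2) * 2 ^ m * exp (- (x / 2))).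
- apply Rmult_le_compat_r; [left; apply exp_pos|].
  apply Rmult_le_compat_r; [apply pow_le; lra | exact H].
- right; rewrite exp_Ropp; pose proof (exp_pos (x / 2)); field; lra.
Qed.

(** The derivative of order [q] in [t] of the function equal to
    [exp (- s / t) / t ^ j] for [t > 0] and to [0] for [t <= 0]. The recursion
    differentiates once and keeps [q] derivatives of the two resulting
    kernels. *)
Fixpoint flatker (j q : nat) (s t : R) : R :=
  match q with
  | O => if Rlt_dec 0 t then exp (- (s / t)) * (/ t) ^ j else 0
  | S p => s * flatker (S (S j)) p s t - INR j * flatker (S j) p s t
  end.

Lemma flatker_nonpos (q : nat) (s t : R) : t <= 0 -> forall j, flatker j q s t = 0.
Proof.
intros ht; induction q as [|q IH]; intros j; simpl.
- destruct (Rlt_dec 0 t); lra.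
- rewrite !IH; ring.
Qed.

Lemma is_derive_flatker_s (q : nat) (t : R) : 0 < t -> forall j s,
  is_derive (fun s => flatker j q s t) s (- flatker (S j) q s t).
Proof.
intros ht; induction q as [|q IH]; intros j s; cbn [flatker].
- destruct (Rlt_dec 0 t) as [_|N]; [|lra].
  auto_derive; [lra|]; simpl; unfold Rdiv; ring.
- replace (- (s * flatker (S (S (S j))) q s t - INR (S j) * flatker (S (S j)) q s t))
    with ((1 * flatker (S (S j)) q s t + s * - flatker (S (S (S j))) q s t)
          - INR j * - flatker (S (S j)) q s t) by (rewrite S_INR; ring).
  apply (is_derive_minus (V := R_NormedModule)).
  + apply (is_derive_mult_R (fun s => s) (fun s => flatker (S (S j)) q s t));
      [apply (is_derive_id s) | apply IH].
  + apply is_derive_scal, IH.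
Qed.

Lemma is_derive_flat (f : R -> R) (M : R) :
  f 0 = 0 -> (forall z, Rabs (f z) <= M * z ^ 2) -> is_derive f 0 0.
Proof.
intros f0 H; split; [exact (is_linear_scal_l 0)|].
intros x' Hx' eps.
assert (E : x' = 0).
{ symmetry; apply is_filter_lim_locally_unique; exact Hx'. }
subst x'.
assert (hM : 0 <= M).
{ pose proof (H 1); pose proof (Rabs_pos (f 1)); simpl in *; lra. }
assert (hd : 0 < eps / (M + 1)).
{ apply Rdiv_lt_0_compat; [apply cond_pos | lra]. }
exists (mkposreal _ hd); intros z Hz.
change (Rabs (f z - f 0 - (z - 0) * 0) <= eps * Rabs (z - 0)).
assert (Hz' : Rabs (z - 0) < eps / (M + 1)) by exact Hz.
rewrite f0; replace (f z - 0 - (z - 0) * 0) with (f z) by ring.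
eapply Rle_trans; [apply H|].
replace (z ^ 2) with (Rabs (z - 0) * Rabs (z - 0)).
2:{ rewrite <- Rabs_mult, Rabs_pos_eq; [ring | apply Rle_0_sqr]. }
rewrite <- Rmult_assoc; apply Rmult_le_compat_r; [apply Rabs_pos|].
apply Rle_trans with ((M + 1) * Rabs (z - 0)).
- apply Rmult_le_compat_r; [apply Rabs_pos | lra].
- apply Rmult_lt_compat_l with (r := M + 1) in Hz'; [|lra].
  replace ((M + 1) * (eps / (M + 1))) with (pos eps) in Hz' by (field; lra).
  lra.
Qed.

Lemma flatker_0_bound (j : nat) (s t : R) : 0 < s ->
  Rabs (flatker j 0 s t) <= facR (j + 2) / s ^ (j + 2) * t ^ 2.
Proof.
intros hs; cbn [flatker].
assert (P : 0 < facR (j + 2) / s ^ (j + 2)).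
{ apply Rdiv_lt_0_compat; [apply facR_pos | apply pow_lt, hs]. }
destruct (Rlt_dec 0 t) as [ht|N].
- rewrite Rabs_pos_eq.
  2:{ apply Rmult_le_pos; [left; apply exp_pos|].
      apply pow_le; left; apply Rinv_0_lt_compat, ht. }
  pose proof (pow_le_exp (s / t) (j + 2)
    ltac:(left; apply Rdiv_lt_0_compat; assumption)) as H.
  rewrite exp_Ropp; pose proof (exp_pos (s / t)) as He.
  apply (Rmult_le_reg_r (exp (s / t) * s ^ (j + 2) / t ^ 2)).
  { apply Rdiv_lt_0_compat; [apply Rmult_lt_0_compat; [exact He|] |];
    apply pow_lt; assumption. }
  replace (/ exp (s / t) * (/ t) ^ j * (exp (s / t) * s ^ (j + 2) / t ^ 2))
    with ((s / t) ^ (j + 2)).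
  2:{ unfold Rdiv; rewrite Rpow_mult_distr, pow_add.
      rewrite (pow_add (/ t)), !pow_inv; field; repeat split; try lra.
      apply pow_nonzero; lra. }
  eapply Rle_trans; [exact H|]; right; field; split; [|apply pow_nonzero]; lra.
- rewrite Rabs_R0; apply Rmult_le_pos; [lra | apply pow2_ge_0].
Qed.

Lemma is_derive_flatker_t (q : nat) (s t : R) : 0 < s -> forall j,
  is_derive (flatker j q s) t (flatker j (S q) s t).
Proof.
intros hs; induction q as [|q IH]; intros j.
- destruct (Rlt_dec 0 t) as [ht|N]; [|destruct (Req_dec t 0) as [E|E]].
  + apply (is_derive_ext_loc (fun t => exp (- (s / t)) * (/ t) ^ j)).
    * exists (mkposreal _ ht); intros z Hz; simpl.
      assert (Hz' : Rabs (z - t) < t) by exact Hz.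
      apply Rabs_def2 in Hz'; destruct (Rlt_dec 0 z); [reflexivity | lra].
    * simpl; destruct (Rlt_dec 0 t); [|lra].
      auto_derive; [split; lra|].
      destruct j as [|j]; simpl pred; simpl pow; [simpl INR|];
        rewrite Rinv_mult; unfold Rdiv; ring.
  + subst t; rewrite flatker_nonpos by lra.
    apply (is_derive_flat _ (facR (j + 2) / s ^ (j + 2))).
    * apply flatker_nonpos; lra.
    * intros z; apply flatker_0_bound, hs.
  + rewrite flatker_nonpos by lra.
    apply (is_derive_ext_loc (fun _ => 0)).
    * assert (ht : 0 < - t) by lra.
      exists (mkposreal _ ht); intros z Hz.
      assert (Hz' : Rabs (z - t) < - t) by exact Hz.
      apply Rabs_def2 in Hz'; symmetry; apply flatker_nonpos; lra.
    * apply (is_derive_const (V := R_NormedModule) 0).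
- simpl flatker; apply (is_derive_minus (V := R_NormedModule)); apply is_derive_scal, IH.
Qed.

(** [kcoef j q k] is [C(q + j, j + k) / k!], the coefficient of [x ^ k * w ^ q]
    in [(1 - w) ^ (- (j + 1)) * exp (x * w / (1 - w))]. Up to signs this is the
    Taylor expansion of the kernel of index [j + 1] at [t], in the variable
    [w = - h / t] and with [x = s / t]. *)
Definition kcoef (j q k : nat) : R :=
  if Nat.leb k q
  then facR (q + j) / (facR (q - k) * facR (j + k) * facR k) else 0.

Lemma kcoef_rec j q k :
  (INR q + 1) * kcoef j (S q) k =
  (INR j + 1) * kcoef (S j) q k +
  match k with O => 0 | S k' => kcoef (S (S j)) q k' end.
Proof.
pose proof (pos_INR q); pose proof (pos_INR j); pose proof (pos_INR k).
unfold kcoef; destruct (Nat.leb_spec k (S q)) as [L1|L1].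
2:{ destruct (Nat.leb_spec k q); [lia|]; destruct k as [|k]; [lia|].
    destruct (Nat.leb_spec k q); [lia|ring]. }
replace (S q + j)%nat with (S (q + j)) by lia.
replace (q + S j)%nat with (S (q + j)) by lia.
destruct (Nat.leb_spec k q) as [L2|L2].
- replace (S q - k)%nat with (S (q - k)) by lia.
  replace (S j + k)%nat with (S (j + k)) by lia.
  pose proof (facR_neq (q - k)); pose proof (facR_neq (j + k)).
  pose proof (facR_neq (q + j)).
  destruct k as [|k].
  + rewrite !facR_S, minus_INR, !plus_INR by lia; simpl (INR 0).
    replace (j + 0)%nat with j in * by lia.
    replace (q - 0)%nat with q in * by lia.
    simpl (facR 0); field; repeat split; try assumption; lra.
  + destruct (Nat.leb_spec k q) as [_|]; [|lia].
    replace (q + S (S j))%nat with (S (S (q + j))) by lia.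
    replace (q - k)%nat with (S (q - S k)) by lia.
    replace (S (S j) + k)%nat with (S (j + S k)) by lia.
    rewrite !facR_S, S_INR, minus_INR, !plus_INR by lia.
    pose proof (facR_neq k).
    rewrite !S_INR in *.
    assert (INR k + 1 <= INR q) by (rewrite <- S_INR; apply le_INR; exact L2).
    pose proof (pos_INR k).
    field; repeat split; try assumption; lra.
- assert (k = S q) by lia; subst k.
  destruct (Nat.leb_spec q q) as [_|]; [|lia].
  rewrite !Nat.sub_diag.
  replace (q + S (S j))%nat with (S (S (q + j))) by lia.
  replace (j + S q)%nat with (S (q + j)) by lia.
  replace (S (S j) + q)%nat with (S (S (q + j))) by lia.
  rewrite (facR_S q); pose proof (facR_neq q).
  pose proof (facR_neq (S (q + j))); pose proof (facR_neq (S (S (q + j)))).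
  simpl (facR 0); field; repeat split; try assumption; lra.
Qed.

Lemma flatker_bound_sum (s t : R) : 0 <= s -> 0 < t -> forall q j,
  Rabs (flatker (S j) q s t) <=
  facR q * exp (- (s / t)) * (/ t) ^ (S j + q) *
  sum_f_R0 (fun k => kcoef j q k * (s / t) ^ k) q.
Proof.
intros hs ht; assert (hi : 0 < / t) by (apply Rinv_0_lt_compat, ht).
induction q as [|q IH]; intros j.
- simpl flatker; destruct (Rlt_dec 0 t); [|lra]; simpl sum_f_R0.
  rewrite Rabs_pos_eq.
  2:{ apply Rmult_le_pos; [left; apply exp_pos | apply (pow_le (/ t) (S j)); lra]. }
  right; unfold kcoef; simpl Nat.leb; cbv iota; simpl (0 - 0)%nat; simpl (0 + j)%nat.
  rewrite !Nat.add_0_r; simpl; field; pose proof (facR_neq j); split; lra.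
- cbn [flatker].
  apply Rle_trans with (s * Rabs (flatker (S (S (S j))) q s t) +
    INR (S j) * Rabs (flatker (S (S j)) q s t)).
  { unfold Rminus; eapply Rle_trans; [apply Rabs_triang|].
    rewrite Rabs_Ropp, !Rabs_mult, (Rabs_pos_eq s), (Rabs_pos_eq (INR (S j)));
      [lra | apply pos_INR | exact hs]. }
  eapply Rle_trans.
  { apply Rplus_le_compat; apply Rmult_le_compat_l; [exact hs | apply IH |
      apply pos_INR | apply IH]. }
  set (x := s / t).
  set (A := sum_f_R0 (fun k => kcoef (S (S j)) q k * x ^ k) q).
  set (B := sum_f_R0 (fun k => kcoef (S j) q k * x ^ k) q).
  assert (E : (INR q + 1) * sum_f_R0 (fun k => kcoef j (S q) k * x ^ k) (S q) =
    x * A + (INR j + 1) * B).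
  { rewrite scal_sum.
    rewrite (sum_eq _ (fun k => (match k with O => 0 | S k' =>
      kcoef (S (S j)) q k' end) * x ^ k + (INR j + 1) * (kcoef (S j) q k * x ^ k))).
    2:{ intros k _; rewrite Rmult_comm, <- Rmult_assoc, kcoef_rec; ring. }
    rewrite sum_plus; f_equal.
    - rewrite decomp_sum by lia; simpl pred; rewrite Rmult_0_l, Rplus_0_l.
      unfold A; rewrite scal_sum; apply sum_eq; intros k _; simpl; ring.
    - rewrite tech5; unfold kcoef at 2.
      destruct (Nat.leb_spec (S q) q); [lia|].
      unfold B; rewrite scal_sum, Rmult_0_l, Rmult_0_r, Rplus_0_r.
      apply sum_eq; intros; ring. }
  rewrite facR_S, S_INR.
  replace ((INR q + 1) * facR q * exp (- x) * (/ t) ^ (S j + S q) *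
    sum_f_R0 (fun k => kcoef j (S q) k * x ^ k) (S q)) with
    (facR q * exp (- x) * (/ t) ^ (S j + S q) * ((INR q + 1) *
    sum_f_R0 (fun k => kcoef j (S q) k * x ^ k) (S q))) by ring.
  rewrite E; right.
  replace (S (S (S j)) + q)%nat with (S (S j + S q)) by lia.
  replace (S (S j) + q)%nat with (S j + S q)%nat by lia.
  simpl pow; unfold x, Rdiv; ring.
Qed.

Lemma sum_kcoef_le (j q : nat) (x : R) : 0 <= x ->
  sum_f_R0 (fun k => kcoef j q k * x ^ k) q <=
  exp (x / 2) * sum_f_R0 (fun k => Binomial.C (q + j) (j + k) * 2 ^ k) q.
Proof.
intros hx; rewrite scal_sum; apply sum_Rle; intros k Hk.
pose proof (pow_le_exp (x / 2) k ltac:(lra)) as H.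
replace (kcoef j q k * x ^ k) with (Binomial.C (q + j) (j + k) * 2 ^ k *
  ((x / 2) ^ k / facR k)).
2:{ unfold kcoef, Binomial.C; destruct (Nat.leb_spec k q); [|lia].
    replace (q + j - (j + k))%nat with (q - k)%nat by lia.
    replace (x ^ k) with ((x / 2) ^ k * 2 ^ k).
    2:{ rewrite <- Rpow_mult_distr; f_equal; field. }
    field; repeat split; apply facR_neq. }
apply Rmult_le_compat_l.
- apply Rmult_le_pos; [|apply pow_le; lra].
  unfold Binomial.C; left; apply Rdiv_lt_0_compat; [apply facR_pos|].
  apply Rmult_lt_0_compat; apply facR_pos.
- apply (Rmult_le_reg_l (facR k)); [apply facR_pos|].
  replace (facR k * ((x / 2) ^ k / facR k)) with ((x / 2) ^ k); [exact H|].
  field; apply facR_neq.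
Qed.

Lemma sum_binomial_2 (q : nat) :
  sum_f_R0 (fun k => Binomial.C q k * 2 ^ k) q = 3 ^ q.
Proof.
replace 3 with (2 + 1) by ring; rewrite binomial; apply sum_eq; intros k _.
rewrite pow1; ring.
Qed.

Lemma sum_binomial_2_shift (q : nat) :
  sum_f_R0 (fun k => Binomial.C (q + 1) (1 + k) * 2 ^ k) q <= 3 ^ (q + 1) / 2.
Proof.
rewrite <- sum_binomial_2.
replace (q + 1)%nat with (S q) by lia.
rewrite (decomp_sum _ (S q)) by lia; simpl pred.
rewrite (sum_eq (fun k => Binomial.C (S q) (S k) * 2 ^ S k)
  (fun k => Binomial.C (S q) (1 + k) * 2 ^ k * 2)).
2:{ intros k _; simpl; ring. }
rewrite <- scal_sum, C_n_0; simpl (2 ^ 0); lra.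
Qed.

Lemma flatker_bound (j q : nat) (s t K : R) : 0 <= s -> 0 < t ->
  sum_f_R0 (fun k => Binomial.C (q + j) (j + k) * 2 ^ k) q <= K ->
  s ^ (S j + q) * Rabs (flatker (S j) q s t) <=
  K * facR q * facR (S j + q) * 2 ^ (S j + q).
Proof.
intros hs ht HK; set (m := (S j + q)%nat).
assert (hx : 0 <= s / t).
{ apply Rmult_le_pos; [exact hs | left; apply Rinv_0_lt_compat, ht]. }
assert (HK0 : 0 <= K).
{ eapply Rle_trans; [|exact HK]; apply cond_pos_sum; intros k.
  apply Rmult_le_pos; [|apply pow_le; lra].
  unfold Binomial.C; left; apply Rdiv_lt_0_compat; [apply facR_pos|].
  apply Rmult_lt_0_compat; apply facR_pos. }
pose proof (flatker_bound_sum s t hs ht q j) as H1; fold m in H1.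
pose proof (sum_kcoef_le j q (s / t) hx) as H2.
pose proof (pow_mult_exp_le (s / t) m hx) as H3.
assert (H4 : sum_f_R0 (fun k => kcoef j q k * (s / t) ^ k) q <= exp (s / t / 2) * K).
{ eapply Rle_trans; [exact H2|]; apply Rmult_le_compat_l; [left; apply exp_pos | exact HK]. }
pose proof (facR_pos q) as Pq.
assert (Pm : 0 <= (/ t) ^ m) by (apply pow_le; left; apply Rinv_0_lt_compat, ht).
apply Rle_trans with (s ^ m * (facR q * exp (- (s / t)) * (/ t) ^ m * (exp (s / t / 2) * K))).
{ apply Rmult_le_compat_l; [apply pow_le; exact hs|].
  eapply Rle_trans; [exact H1|].
  apply Rmult_le_compat_l; [|exact H4].
  apply Rmult_le_pos; [|exact Pm]; apply Rmult_le_pos; [lra | left; apply exp_pos]. }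
replace (s ^ m * (facR q * exp (- (s / t)) * (/ t) ^ m * (exp (s / t / 2) * K)))
  with (K * facR q * ((s / t) ^ m * (exp (- (s / t)) * exp (s / t / 2)))).
2:{ unfold Rdiv at 1; rewrite Rpow_mult_distr; ring. }
rewrite <- exp_plus; replace (- (s / t) + s / t / 2) with (- (s / t / 2)) by (field; lra).
rewrite (Rmult_assoc _ (facR m)).
apply Rmult_le_compat_l; [apply Rmult_le_pos; lra | exact H3].
Qed.

Lemma flatker_1_bound (q : nat) (s t : R) : 0 <= s ->
  s ^ S q * Rabs (flatker 1 q s t) <= 2 * facR q * facR (S q) * 6 ^ q.
Proof.
intros hs; destruct (Rlt_dec 0 t) as [ht|N].
- eapply Rle_trans.
  + apply (flatker_bound 0 q s t (3 ^ q) hs ht); right.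
    rewrite Nat.add_0_r; apply sum_binomial_2.
  + right; replace 6 with (3 * 2) by ring; rewrite Rpow_mult_distr; simpl; ring.
- rewrite flatker_nonpos, Rabs_R0, Rmult_0_r by lra.
  pose proof (facR_pos q); pose proof (facR_pos (S q)).
  pose proof (pow_le 6 q ltac:(lra)).
  repeat apply Rmult_le_pos; lra.
Qed.

Lemma flatker_2_bound (q : nat) (s t : R) : 0 <= s ->
  s ^ S (S q) * Rabs (flatker 2 q s t) <= facR q * facR (S (S q)) * 6 ^ S q.
Proof.
intros hs; destruct (Rlt_dec 0 t) as [ht|N].
- eapply Rle_trans.
  + apply (flatker_bound 1 q s t (3 ^ (q + 1) / 2) hs ht), sum_binomial_2_shift.
  + right; replace 6 with (3 * 2) by ring; rewrite Rpow_mult_distr.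
    replace (q + 1)%nat with (S q) by lia; simpl; field.
- rewrite flatker_nonpos, Rabs_R0, Rmult_0_r by lra.
  pose proof (facR_pos q); pose proof (facR_pos (S (S q))).
  pose proof (pow_le 6 (S q) ltac:(lra)).
  apply Rmult_le_pos; [apply Rmult_le_pos|]; lra.
Qed.

(** * Truncated monomials *)

(** For [t > 0] this is the truncated Laplace transform
    [1 / p! * \int_0^s (u ^ p * exp (- u / t) / t) du], and the recursion is
    integration by parts. The integral up to infinity is [t ^ p]; the truncated
    one differs from it by a flat function at [0], but stays below
    [s ^ p / p!] for all [t > 0]. *)
Fixpoint truncmono0 (p : nat) (s t : R) : R :=
  match p with
  | O => 1 - flatker 0 0 s t
  | S m => t * truncmono0 m s t - s ^ S m / facR (S m) * flatker 0 0 s t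
  end.

(** The derivative of order [q] in [t] of [truncmono0 p]. One differentiation of
    the monomial of degree [p] gives [p] times that of degree [p - 1], up to
    kernels at [u = s]. *)
Fixpoint truncmono (q p : nat) (s t : R) : R :=
  match q with
  | O => truncmono0 p s t
  | S r => INR p * truncmono r (pred p) s t -
           s ^ p / facR p * (INR p * flatker 1 r s t + s * flatker 2 r s t)
  end.

Lemma flatker_0_mult (j : nat) (s t : R) : t * flatker (S j) 0 s t = flatker j 0 s t.
Proof.
cbn [flatker]; destruct (Rlt_dec 0 t); simpl; [field; lra | ring].
Qed.

Lemma is_derive_truncmono_t (s : R) : 0 < s -> forall q p t,
  is_derive (truncmono q p s) t (truncmono (S q) p s t).
Proof.
intros hs; induction q as [|q IH].
- assert (E0 : forall t, is_derive (flatker 0 0 s) t (s * flatker 2 0 s t)).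
  { intros t; replace (s * flatker 2 0 s t) with (flatker 0 1 s t);
    [apply is_derive_flatker_t, hs | simpl; ring]. }
  induction p as [|p IH]; intros t.
  + replace (truncmono 1 0 s t) with (0 - s * flatker 2 0 s t).
    2:{ cbn [truncmono pred]; change (INR 0) with 0; change (s ^ 0) with 1.
        change (facR 0) with 1; field. }
    apply (is_derive_minus (V := R_NormedModule)); [|apply E0].
    apply (is_derive_const (V := R_NormedModule) 1).
  + assert (H : is_derive (truncmono 0 (S p) s) t
      (1 * truncmono0 p s t + t * truncmono 1 p s t -
       s ^ S p / facR (S p) * (s * flatker 2 0 s t))).
    { apply (is_derive_minus (V := R_NormedModule) (fun t => t * truncmono0 p s t)
        (fun t => s ^ S p / facR (S p) * flatker 0 0 s t)).
      - apply (is_derive_mult_R (fun t => t) (truncmono0 p s));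
          [apply (is_derive_id t) | apply IH].
      - apply is_derive_scal, E0. }
    replace (truncmono 1 (S p) s t) with
      (1 * truncmono0 p s t + t * truncmono 1 p s t -
       s ^ S p / facR (S p) * (s * flatker 2 0 s t)); [exact H|].
    cbn [truncmono pred].
    pose proof (flatker_0_mult 1 s t) as K2; pose proof (flatker_0_mult 0 s t) as K1.
    assert (HP : INR p * (t * truncmono0 (pred p) s t) =
      INR p * (truncmono0 p s t + s ^ p / facR p * flatker 0 0 s t)).
    { destruct p as [|p]; [simpl; ring|]; cbn [truncmono0 pred]; ring. }
    rewrite <- K1 in HP; rewrite <- K2 in HP.
    rewrite <- K2.
    replace (t * (INR p * truncmono0 (pred p) s t - s ^ p / facR p *
      (INR p * (t * flatker 2 0 s t) + s * flatker 2 0 s t))) with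
      (INR p * (t * truncmono0 (pred p) s t) - t * (s ^ p / facR p *
      (INR p * (t * flatker 2 0 s t) + s * flatker 2 0 s t))) by ring.
    rewrite HP, facR_S, S_INR; simpl (s ^ S p).
    pose proof (facR_neq p); pose proof (pos_INR p); field.
    split; [assumption | lra].
- intros p t; cbn [truncmono].
  apply (is_derive_minus (V := R_NormedModule)).
  + apply is_derive_scal, (IH (pred p)).
  + apply is_derive_scal.
    apply (is_derive_plus (V := R_NormedModule));
      apply is_derive_scal, is_derive_flatker_t, hs.
Qed.

(** The integrand of the Laplace transform, differentiated [q] times in [t]:
    this is how the integral representation enters, without integrals. *)
Lemma is_derive_truncmono_s (t : R) : 0 < t -> forall q p s,
  is_derive (fun s => truncmono q p s t) s (s ^ p / facR p * flatker 1 q s t).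
Proof.
intros ht.
assert (DP : forall p s, is_derive (fun s => s ^ S p / facR (S p)) s (s ^ p / facR p)).
{ intros p s.
  apply (is_derive_ext (fun s => / facR (S p) * s ^ S p)).
  { intros u; unfold Rdiv; apply Rmult_comm. }
  replace (s ^ p / facR p) with (/ facR (S p) * (INR (S p) * 1 * s ^ pred (S p))).
  - apply is_derive_scal.
    apply (is_derive_pow (fun s => s) (S p) s 1), (is_derive_id s).
  - simpl pred; rewrite facR_S, S_INR; pose proof (facR_neq p); pose proof (pos_INR p).
    field; split; [assumption | lra]. }
induction q as [|q IH].
- induction p as [|p IH]; intros s.
  + replace (s ^ 0 / facR 0 * flatker 1 0 s t) with (0 - - flatker 1 0 s t).
    2:{ change (s ^ 0) with 1; change (facR 0) with 1; field. }
    apply (is_derive_minus (V := R_NormedModule) (fun _ => 1) (fun s => flatker 0 0 s t)).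
    * apply (is_derive_const (V := R_NormedModule) 1).
    * apply is_derive_flatker_s, ht.
  + replace (s ^ S p / facR (S p) * flatker 1 0 s t) with
      (t * (s ^ p / facR p * flatker 1 0 s t) - (s ^ p / facR p * flatker 0 0 s t +
       s ^ S p / facR (S p) * - flatker 1 0 s t)).
    2:{ rewrite <- (flatker_0_mult 0); ring. }
    cbn [truncmono truncmono0].
    apply (is_derive_minus (V := R_NormedModule) (fun s => t * truncmono0 p s t)
      (fun s => s ^ S p / facR (S p) * flatker 0 0 s t)).
    * apply is_derive_scal, IH.
    * apply (is_derive_mult_R (fun s => s ^ S p / facR (S p))
        (fun s => flatker 0 0 s t)); [apply DP | apply is_derive_flatker_s, ht].
- intros p s; cbn [truncmono].
  set (k := fun s => INR p * flatker 1 q s t + s * flatker 2 q s t).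
  assert (Dk : is_derive k s
    (INR p * - flatker 2 q s t + (1 * flatker 2 q s t + s * - flatker 3 q s t))).
  { apply (is_derive_plus (V := R_NormedModule)).
    - apply is_derive_scal, is_derive_flatker_s, ht.
    - apply (is_derive_mult_R (fun s => s) (fun s => flatker 2 q s t));
        [apply (is_derive_id s) | apply is_derive_flatker_s, ht]. }
  destruct p as [|p].
  + replace (s ^ 0 / facR 0 * flatker 1 (S q) s t) with
      (0 - 1 / 1 * (INR 0 * - flatker 2 q s t + (1 * flatker 2 q s t + s * - flatker 3 q s t)))
      by (cbn [flatker]; change (s ^ 0) with 1; change (facR 0) with 1;
          change (INR 0) with 0; change (INR 1) with 1; field).
    apply (is_derive_minus (V := R_NormedModule)).
    * simpl (INR 0); apply (is_derive_ext (fun _ => 0)); [intros u; symmetry; apply Rmult_0_l|].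
      apply (is_derive_const (V := R_NormedModule) 0).
    * apply (is_derive_scal k s (1 / 1)); exact Dk.
  + simpl pred.
    replace (s ^ S p / facR (S p) * flatker 1 (S q) s t) with
      (INR (S p) * (s ^ p / facR p * flatker 1 q s t) -
       (s ^ p / facR p * k s + s ^ S p / facR (S p) *
       (INR (S p) * - flatker 2 q s t + (1 * flatker 2 q s t + s * - flatker 3 q s t)))).
    2:{ unfold k; cbn [flatker]; rewrite facR_S, S_INR; simpl (s ^ S p); simpl (INR 1).
        pose proof (facR_neq p); pose proof (pos_INR p); field.
        split; [assumption | lra]. }
    apply (is_derive_minus (V := R_NormedModule)
      (fun s => INR (S p) * truncmono q p s t)
      (fun s => s ^ S p / facR (S p) * k s)).
    * apply is_derive_scal, IH.
    * apply (is_derive_mult_R (fun s => s ^ S p / facR (S p)) k); [apply DP | exact Dk].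
Qed.

Lemma truncmono_s_0 (t : R) : 0 < t -> forall q p, truncmono q p 0 t = 0.
Proof.
intros ht; assert (E : flatker 0 0 0 t = 1).
{ cbn [flatker]; destruct (Rlt_dec 0 t); [|lra].
  unfold Rdiv; rewrite Rmult_0_l, Ropp_0, exp_0; simpl; ring. }
induction q as [|q IH].
- induction p as [|p IHp]; cbn [truncmono truncmono0] in *; rewrite E; [ring|].
  rewrite IHp; simpl (0 ^ S p); unfold Rdiv; ring.
- intros p; cbn [truncmono]; rewrite IH.
  destruct p as [|p]; [simpl (INR 0) | simpl (0 ^ S p)]; unfold Rdiv; ring.
Qed.

Lemma truncmono_t_0 (s : R) : forall q p,
  truncmono q p s 0 = if Nat.eq_dec p q then facR p else 0.
Proof.
assert (E : forall j q, flatker j q s 0 = 0) by (intros; apply flatker_nonpos; lra).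
induction q as [|q IH].
- intros p; destruct p as [|p]; cbn [truncmono truncmono0]; rewrite E.
  + simpl; ring.
  + destruct (Nat.eq_dec (S p) 0); [lia | ring].
- intros p; cbn [truncmono]; rewrite !E, IH; destruct p as [|p]; simpl pred.
  + destruct (Nat.eq_dec 0 (S q)); [lia|]; simpl (INR 0); ring.
  + rewrite facR_S, S_INR.
    destruct (Nat.eq_dec p q), (Nat.eq_dec (S p) (S q)); try lia; ring.
Qed.

(** Up to the factor [2 (q + 1)], the bound [q! ^ 2 / (s / 6) ^ q] of a Gevrey function
    of order [2], multiplied by the size [s ^ p / p!] of the function itself. *)
Definition truncmono_size (q p : nat) (s : R) : R :=
  2 * facR q * facR (S q) * 6 ^ q * (s ^ p / (facR p * s ^ q)).

(** The integrand, differentiated [q] times, is of size [u ^ (p - q - 1)]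
    uniformly in [t]. For [q < p] it is therefore bounded on [[0, s]], and the
    function is estimated by the length of this interval times the maximum. The
    terms of the closed formula in [t] are much larger and cancel. *)
Lemma truncmono_bound_lt (q p : nat) (s t : R) : (q < p)%nat -> 0 < s -> 0 < t ->
  Rabs (truncmono q p s t) <= truncmono_size q p s.
Proof.
intros hqp hs ht.
replace (truncmono q p s t) with (truncmono q p s t - truncmono q p 0 t)
  by (rewrite truncmono_s_0 by exact ht; ring).
pose proof (facR_pos p) as Pp.
set (K := 2 * facR q * facR (S q) * 6 ^ q / facR p).
assert (HK : 0 <= K).
{ unfold K; left; apply Rdiv_lt_0_compat; [|exact Pp].
  pose proof (facR_pos q); pose proof (facR_pos (S q)).
  pose proof (pow_lt 6 q ltac:(lra)); repeat apply Rmult_lt_0_compat; lra. }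
eapply Rle_trans.
- apply (lipschitz_on 0 s (K * s ^ (p - q - 1)) (fun u => truncmono q p u t)
    (fun u => u ^ p / facR p * flatker 1 q u t) 0 s); try lra.
  + intros u hu; apply is_derive_on_is_derive; [exact hu|].
    apply is_derive_truncmono_s, ht.
  + intros u hu; replace (u ^ p) with (u ^ (p - q - 1) * u ^ S q).
    2:{ rewrite <- pow_add; f_equal; lia. }
    assert (P1 : 0 <= u ^ (p - q - 1)) by (apply pow_le; lra).
    assert (P2 : 0 <= u ^ S q) by (apply pow_le; lra).
    rewrite Rabs_mult, Rabs_pos_eq.
    2:{ apply Rmult_le_pos; [apply Rmult_le_pos; assumption|].
        left; apply Rinv_0_lt_compat, Pp. }
    replace (u ^ (p - q - 1) * u ^ S q / facR p * Rabs (flatker 1 q u t)) with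
      (u ^ (p - q - 1) * ((u ^ S q * Rabs (flatker 1 q u t)) / facR p)) by
      (unfold Rdiv; ring).
    rewrite (Rmult_comm K).
    apply Rmult_le_compat; [exact P1 | | apply pow_incr; lra |].
    * apply Rmult_le_pos; [apply Rmult_le_pos; [exact P2 | apply Rabs_pos] |].
      left; apply Rinv_0_lt_compat, Pp.
    * unfold K, Rdiv; apply Rmult_le_compat_r;
        [left; apply Rinv_0_lt_compat, Pp | apply flatker_1_bound; lra].
- right; rewrite Rabs_pos_eq by lra; unfold K, truncmono_size.
  replace (s ^ p) with (s ^ (p - q - 1) * (s * s ^ q)).
  2:{ change (s * s ^ q) with (s ^ S q); rewrite <- pow_add; f_equal; lia. }
  pose proof (pow_nonzero s q ltac:(lra)); field; split; lra.
Qed.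

(** For [p <= q] the derivative of [t ^ p] is constant, and what remains is a
    combination of kernels at [u = s], whose sizes decrease geometrically along
    the recursion, by the factor [6]. *)
Lemma truncmono_bound_ge (s t : R) : 0 < s -> forall p q, (p <= q)%nat ->
  Rabs (truncmono q p s t) <= truncmono_size q p s.
Proof.
intros hs.
assert (KB1 : forall q, Rabs (flatker 1 q s t) <= 2 * facR q * facR (S q) * 6 ^ q / s ^ S q).
{ intros q; pose proof (pow_lt s (S q) hs).
  apply (Rmult_le_reg_l (s ^ S q)); [assumption|].
  replace (s ^ S q * (2 * facR q * facR (S q) * 6 ^ q / s ^ S q)) with
    (2 * facR q * facR (S q) * 6 ^ q) by (field; lra).
  apply flatker_1_bound; lra. }
assert (KB2 : forall q, Rabs (flatker 2 q s t) <=
  facR q * facR (S (S q)) * 6 ^ S q / s ^ S (S q)).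
{ intros q; pose proof (pow_lt s (S (S q)) hs).
  apply (Rmult_le_reg_l (s ^ S (S q))); [assumption|].
  replace (s ^ S (S q) * (facR q * facR (S (S q)) * 6 ^ S q / s ^ S (S q))) with
    (facR q * facR (S (S q)) * 6 ^ S q) by (field; lra).
  apply flatker_2_bound; lra. }
assert (step : forall p q X, (p <= S q)%nat ->
  INR p * Rabs X <= INR p * truncmono_size q (pred p) s ->
  Rabs (INR p * X - s ^ p / facR p * (INR p * flatker 1 q s t + s * flatker 2 q s t)) <=
  truncmono_size (S q) p s).
{ intros p q X hpq HX.
  pose proof (pos_INR p) as P0; pose proof (pos_INR q) as Q0.
  assert (PQ : INR p <= INR q + 1) by (rewrite <- S_INR; apply le_INR; exact hpq).
  pose proof (facR_pos p) as Pp; pose proof (facR_pos q) as Pq.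
  pose proof (pow_lt s p hs) as Sp; pose proof (pow_lt s q hs) as Sq.
  pose proof (pow_lt 6 q ltac:(lra)) as P6.
  set (W := facR q * facR q * (INR q + 1) * 6 ^ q * s ^ p / (facR p * (s * s ^ q))).
  assert (HW : 0 < W).
  { unfold W; apply Rdiv_lt_0_compat; repeat apply Rmult_lt_0_compat; lra. }
  assert (T1 : INR p * Rabs X <= 2 * (INR q + 1) ^ 2 * W).
  { eapply Rle_trans; [exact HX|].
    destruct p as [|p].
    - simpl (INR 0); rewrite Rmult_0_l; pose proof (pow2_ge_0 (INR q + 1)); nra.
    - simpl pred; unfold truncmono_size, W; rewrite !facR_S in *.
      pose proof (facR_pos p); rewrite !S_INR in *; pose proof (pos_INR p).
      pose proof (pow_lt s p hs).
      replace ((INR p + 1) * (2 * facR q * ((INR q + 1) * facR q) * 6 ^ q *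
        (s ^ p / (facR p * s ^ q)))) with ((INR p + 1) ^ 2 * (2 *
        (facR q * facR q * (INR q + 1) * 6 ^ q * s ^ S p /
        ((INR p + 1) * facR p * (s * s ^ q))))) by (simpl; field; repeat split; lra).
      replace (2 * (INR q + 1) ^ 2 * (facR q * facR q * (INR q + 1) * 6 ^ q *
        s ^ S p / ((INR p + 1) * facR p * (s * s ^ q)))) with
        ((INR q + 1) ^ 2 * (2 * (facR q * facR q * (INR q + 1) * 6 ^ q * s ^ S p /
        ((INR p + 1) * facR p * (s * s ^ q))))) by ring.
      apply Rmult_le_compat_r.
      + left; apply Rmult_lt_0_compat; [lra|]; apply Rdiv_lt_0_compat;
          repeat apply Rmult_lt_0_compat; first [lra | assumption].
      + apply pow_incr; lra. }
  assert (T2 : s ^ p / facR p * (INR p * Rabs (flatker 1 q s t)) <= 2 * (INR q + 1) * W).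
  { apply Rle_trans with (s ^ p / facR p * ((INR q + 1) *
      (2 * facR q * facR (S q) * 6 ^ q / s ^ S q))).
    - apply Rmult_le_compat_l; [left; apply Rdiv_lt_0_compat; assumption|].
      apply Rmult_le_compat; [exact P0 | apply Rabs_pos | exact PQ | apply KB1].
    - right; unfold W; rewrite facR_S; simpl (s ^ S q); field; repeat split; lra. }
  assert (T3 : s ^ p / facR p * (s * Rabs (flatker 2 q s t)) <= 6 * (INR q + 2) * W).
  { apply Rle_trans with (s ^ p / facR p * (s *
      (facR q * facR (S (S q)) * 6 ^ S q / s ^ S (S q)))).
    - apply Rmult_le_compat_l; [left; apply Rdiv_lt_0_compat; assumption|].
      apply Rmult_le_compat_l; [lra | apply KB2].
    - right; unfold W; rewrite !facR_S, S_INR; simpl (s ^ _); simpl (6 ^ _).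
      field; repeat split; lra. }
  apply Rle_trans with (INR p * Rabs X + (s ^ p / facR p * (INR p * Rabs (flatker 1 q s t)) +
    s ^ p / facR p * (s * Rabs (flatker 2 q s t)))).
  { assert (PF : 0 < s ^ p / facR p) by (apply Rdiv_lt_0_compat; assumption).
    unfold Rminus; eapply Rle_trans; [apply Rabs_triang|].
    rewrite Rabs_Ropp, !Rabs_mult, (Rabs_pos_eq (INR p)), (Rabs_pos_eq (s ^ p / facR p))
      by lra.
    rewrite <- Rmult_plus_distr_l; apply Rplus_le_compat_l, Rmult_le_compat_l; [lra|].
    eapply Rle_trans; [apply Rabs_triang|].
    rewrite !Rabs_mult, (Rabs_pos_eq (INR p)), (Rabs_pos_eq s) by lra; lra. }
  replace (truncmono_size (S q) p s) with (12 * (INR q + 1) * (INR q + 2) * W).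
  2:{ unfold truncmono_size, W; rewrite !facR_S, S_INR; simpl (s ^ S q); simpl (6 ^ _).
      field; repeat split; lra. }
  apply Rle_trans with ((2 * (INR q + 1) ^ 2 + 2 * (INR q + 1) + 6 * (INR q + 2)) * W);
    [lra|].
  apply Rmult_le_compat_r; [lra | nra]. }
induction p as [|p IH]; intros q hq.
- destruct q as [|q].
  + unfold truncmono_size; simpl truncmono; simpl (facR _); simpl (_ ^ 0).
    replace (2 * 1 * 1 * 1 * (1 / (1 * 1))) with 2 by field.
    cbn [flatker]; destruct (Rlt_dec 0 t) as [ht|N].
    * assert (H : 0 < s / t) by (apply Rdiv_lt_0_compat; assumption).
      assert (exp (- (s / t)) <= 1) by (rewrite <- exp_0; left; apply exp_increasing; lra).
      pose proof (exp_pos (- (s / t))); simpl; rewrite Rabs_pos_eq; lra.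
    * rewrite Rminus_0_r, Rabs_R1; lra.
  + cbn [truncmono]; apply step; [lia|]; simpl (INR 0); lra.
- destruct q as [|q]; [lia|].
  cbn [truncmono]; apply step; [lia|].
  apply Rmult_le_compat_l; [apply pos_INR|]; apply IH; lia.
Qed.

Lemma truncmono_bound (q p : nat) (s t : R) : 0 < s -> 0 <= t ->
  Rabs (truncmono q p s t) <= truncmono_size q p s.
Proof.
intros hs ht; destruct (Nat.le_gt_cases p q) as [H|H];
  [apply truncmono_bound_ge; assumption|].
destruct (Req_dec t 0) as [E|N]; [|apply truncmono_bound_lt; trivial; lra].
subst t; rewrite truncmono_t_0; destruct (Nat.eq_dec p q); [lia|]; rewrite Rabs_R0.
unfold truncmono_size.
pose proof (facR_pos q); pose proof (facR_pos (S q)); pose proof (facR_pos p).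
pose proof (pow_lt 6 q ltac:(lra)).
left; apply Rmult_lt_0_compat; [repeat apply Rmult_lt_0_compat; lra|].
apply Rdiv_lt_0_compat; [apply pow_lt, hs|].
apply Rmult_lt_0_compat; [assumption | apply pow_lt, hs].
Qed.

(** * Interpolation of two jets *)

Lemma facR_mult_le (a b : nat) : facR a * facR b <= facR (a + b).
Proof.
induction a as [|a IH]; simpl (_ + _)%nat.
- simpl (facR 0); lra.
- rewrite !facR_S, plus_INR; pose proof (pos_INR a); pose proof (pos_INR b).
  pose proof (facR_pos (a + b)).
  apply (Rmult_le_compat_l (INR a + 1)) in IH; [nra | lra].
Qed.

Lemma facR_mult_S_le (q : nat) : facR q * facR (S q) <= facR (2 * q).
Proof.
induction q as [|q IH]; [simpl; lra|].
replace (2 * S q)%nat with (S (S (2 * q))) by lia.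
rewrite !facR_S in *; rewrite !S_INR, mult_INR in *; simpl (INR 2).
pose proof (pos_INR q); pose proof (facR_pos (2 * q)).
replace ((INR q + 1) * facR q * ((INR q + 1 + 1) * ((INR q + 1) * facR q))) with
  ((INR q + 1) * (INR q + 2) * (facR q * ((INR q + 1) * facR q))) by ring.
apply Rle_trans with ((INR q + 1) * (INR q + 2) * facR (2 * q)).
- apply Rmult_le_compat_l; [nra | exact IH].
- rewrite <- Rmult_assoc; apply Rmult_le_compat_r; nra.
Qed.

Lemma Series_single (u : nat -> R) (q : nat) :
  ex_series u -> (forall n, n <> q -> u n = 0) -> Series u = u q.
Proof.
intros X H.
assert (Z : forall v : nat -> R, (forall n, v n = 0) -> Series v = 0).
{ intros v Hv; rewrite (Series_ext v (fun n => 0 * 0)) by (intros; rewrite Hv; ring).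
  rewrite Series_scal_l; ring. }
rewrite (Series_incr_n u (S q)) by (lia || exact X).
rewrite (Z (fun k => u (S q + k)%nat)) by (intros; apply H; lia).
simpl pred; rewrite Rplus_0_r; destruct q as [|q]; [reflexivity|].
rewrite tech5, (sum_eq _ (fun _ => 0)) by (intros; apply H; lia).
rewrite sum_cte; ring.
Qed.

(** Borel's theorem in the Gevrey class of order 2: replacing the monomials of
    the formal Taylor series by their truncations makes it converge. With
    truncation at [s = 12] the terms decrease like [(12 * kap) ^ p], and the
    derivatives grow at the rate [12 / 6 = 2]. *)
Lemma borel_gevrey (kap : R) : 0 < kap -> 12 * kap < 1 ->
  exists K, 0 < K /\ forall (T C : R) (d : nat -> R), 0 < T -> 0 <= C ->
  (forall p, Rabs (d p) <= C * (facR p * facR p) * kap ^ p) ->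
  exists f, tower 0 T f /\ (forall q, f q 0 = d q) /\
    forall q t, 0 <= t <= T -> Rabs (f q t) <= K * C * facR (2 * q) / 2 ^ q.
Proof.
intros hk hk1; exists (2 * / (1 - 12 * kap)).
split; [apply Rmult_lt_0_compat; [lra | apply Rinv_0_lt_compat; lra]|].
intros T C d hT hC Hd.
set (u := fun p q t => d p / facR p * truncmono q p 12 t).
set (M := fun q p => 2 * C * facR (2 * q) / 2 ^ q * (12 * kap) ^ p).
assert (HM : forall p q t, 0 <= t <= T -> Rabs (u p q t) <= M q p).
{ intros p q t ht; unfold u; rewrite Rabs_mult; unfold Rdiv at 1; rewrite Rabs_mult.
  pose proof (facR_pos p); pose proof (pow_lt 2 q ltac:(lra)).
  pose proof (pow_lt kap p hk); pose proof (pow_lt 12 p ltac:(lra)).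
  rewrite (Rabs_pos_eq (/ facR p)) by (left; apply Rinv_0_lt_compat; assumption).
  eapply Rle_trans.
  - apply Rmult_le_compat; [|apply Rabs_pos| |apply truncmono_bound; lra].
    + apply Rmult_le_pos; [apply Rabs_pos | left; apply Rinv_0_lt_compat; assumption].
    + apply Rmult_le_compat_r; [left; apply Rinv_0_lt_compat; assumption | apply Hd].
  - unfold truncmono_size, M; rewrite !Rpow_mult_distr.
    replace (12 ^ q) with (6 ^ q * 2 ^ q).
    2:{ rewrite <- Rpow_mult_distr; f_equal; ring. }
    replace (C * (facR p * facR p) * kap ^ p * / facR p *
      (2 * facR q * facR (S q) * 6 ^ q * (12 ^ p / (facR p * (6 ^ q * 2 ^ q))))) with
      (2 * C / 2 ^ q * (12 ^ p * kap ^ p) * (facR q * facR (S q))).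
    2:{ pose proof (pow_lt 6 q ltac:(lra)); field; repeat split; lra. }
    replace (2 * C * facR (2 * q) / 2 ^ q * (12 ^ p * kap ^ p)) with
      (2 * C / 2 ^ q * (12 ^ p * kap ^ p) * facR (2 * q)) by (unfold Rdiv; ring).
    apply Rmult_le_compat_l; [|apply facR_mult_S_le].
    apply Rmult_le_pos; [apply Rmult_le_pos; [lra|]|].
    + left; apply Rinv_0_lt_compat; assumption.
    + apply Rmult_le_pos; lra. }
assert (hgeo : Rabs (12 * kap) < 1) by (rewrite Rabs_pos_eq; lra).
assert (SM : forall q, ex_series (M q)).
{ intros q; apply (ex_series_scal_l (K := R_AbsRing) _ (fun p => (12 * kap) ^ p)).
  apply ex_series_geom, hgeo. }
exists (fun q t => Series (fun p => u p q t)); split; [|split].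
- apply (tower_Series 0 T u M); [|exact HM|exact SM].
  intros p; apply tower_scal; intros q t ht; apply is_derive_on_is_derive; [exact ht|].
  apply is_derive_truncmono_t; lra.
- intros q; rewrite (Series_single _ q).
  + unfold u; rewrite truncmono_t_0; destruct (Nat.eq_dec q q); [|lia].
    field; apply facR_neq.
  + apply (ex_series_bounded _ (M q)); [|apply SM]; intros p; apply HM; lra.
  + intros p hp; unfold u; rewrite truncmono_t_0; destruct (Nat.eq_dec p q); [lia|ring].
- intros q t ht; eapply Rle_trans.
  + apply (Series_bounded _ (M q)); [|apply SM]; intros p; apply HM; exact ht.
  + unfold M; rewrite Series_scal_l, Series_geom by exact hgeo.
    right; unfold Rdiv; ring.
Qed.

Lemma flatker_0_bound_12 (q : nat) (t : R) :
  Rabs (flatker 0 q 12 t) <= 1 * facR (2 * q) / 2 ^ q.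
Proof.
rewrite Rmult_1_l; destruct q as [|q].
- simpl (2 * 0)%nat; simpl (2 ^ 0); simpl (facR 0); cbn [flatker].
  destruct (Rlt_dec 0 t) as [ht|N]; [|rewrite Rabs_R0; lra].
  assert (H : 0 < 12 / t) by (apply Rdiv_lt_0_compat; lra).
  assert (exp (- (12 / t)) <= 1) by (rewrite <- exp_0; left; apply exp_increasing; lra).
  pose proof (exp_pos (- (12 / t))); simpl; rewrite Rabs_pos_eq; lra.
- replace (flatker 0 (S q) 12 t) with (12 * flatker 2 q 12 t)
    by (cbn [flatker]; simpl (INR 0); ring).
  rewrite Rabs_mult, (Rabs_pos_eq 12) by lra.
  pose proof (pow_lt 2 (S q) ltac:(lra)); pose proof (pow_lt 6 (S q) ltac:(lra)).
  pose proof (flatker_2_bound q 12 t ltac:(lra)) as H2.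
  pose proof (facR_mult_le q (S (S q))) as HF.
  replace (q + S (S q))%nat with (2 * S q)%nat in HF by lia.
  apply (Rmult_le_reg_l (6 ^ S q * 2 ^ S q)); [apply Rmult_lt_0_compat; assumption|].
  replace (6 ^ S q * 2 ^ S q * (12 * Rabs (flatker 2 q 12 t))) with
    (12 ^ S (S q) * Rabs (flatker 2 q 12 t)).
  2:{ change (12 ^ S (S q)) with (12 * 12 ^ S q); rewrite <- Rpow_mult_distr.
      replace (6 * 2) with 12 by ring; ring. }
  replace (6 ^ S q * 2 ^ S q * (facR (2 * S q) / 2 ^ S q)) with
    (facR (2 * S q) * 6 ^ S q) by (field; lra).
  eapply Rle_trans; [exact H2|]; apply Rmult_le_compat_r; lra.
Qed.

(** Products keep the rate [2] of the bounds [(2 q)! / 2 ^ q] at the cost of a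
    factor [2 q + 1]. This is the general Leibniz bound for functions of [t]
    alone. *)
Lemma binsum_gevrey_bound (f g : nat -> R) (A B : R) (q : nat) :
  (forall k, Rabs (f k) <= A * facR (2 * k) / 2 ^ k) ->
  (forall k, Rabs (g k) <= B * facR (2 * k) / 2 ^ k) ->
  Rabs (binsum q (fun k l => f k * g l)) <= A * B * facR (2 * q + 1) / 2 ^ q.
Proof.
intros Hf Hg.
pose proof (leibniz_bound (fun _ k => f k) (fun _ k => g k) A B 1 2 0 q
  ltac:(lra) ltac:(lra)) as H; simpl binsum in H at 1.
rewrite pow1, Rmult_1_l in H; apply H; intros k l hk _;
  replace k with O by lia; simpl (1 ^ 0); rewrite Rmult_1_l; auto.
Qed.

(** The derivative of the cutoff is, up to a constant factor, the product of the
    flat functions [exp (- 12 / t)] and [exp (- 12 / (T - t))]. A short interval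
    [[0, T]] only makes this factor large and leaves the rate [2] unchanged. *)
Lemma gevrey_cutoff (T : R) : 0 < T ->
  exists K phi, 0 < K /\ tower 0 T phi /\ phi O 0 = 1 /\
    (forall q, phi (S q) 0 = 0) /\ (forall q, phi q T = 0) /\
    forall q t, 0 <= t <= T -> Rabs (phi q t) <= K * facR (2 * q) / 2 ^ q.
Proof.
intros hT.
set (psi := fun q t => binsum q (fun k l =>
  flatker 0 k 12 t * ((-1) ^ l * flatker 0 l 12 (T - t)))).
assert (KT : tower 0 T (fun q => flatker 0 q 12)).
{ intros q t ht; apply is_derive_on_is_derive; [exact ht|].
  apply is_derive_flatker_t; lra. }
assert (HT : tower 0 T psi).
{ apply (tower_mult 0 T (fun q => flatker 0 q 12)
    (fun q t => (-1) ^ q * flatker 0 q 12 (T - t))); [exact KT|].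
  apply (tower_reflect T (fun q => flatker 0 q 12)); exact KT. }
assert (HB : forall q t, Rabs (psi q t) <= facR (2 * q + 1) / 2 ^ q).
{ intros q t; eapply Rle_trans.
  - apply (binsum_gevrey_bound _ _ 1 1); intros k.
    + apply flatker_0_bound_12.
    + rewrite Rabs_mult, pow_1_abs, Rmult_1_l; apply flatker_0_bound_12.
  - right; unfold Rdiv; ring. }
assert (C0 : forall t, continuous (psi O) t).
{ intros t; apply (ex_derive_continuous (psi O)); simpl.
  exists (flatker 0 1 12 t * ((-1) ^ 0 * flatker 0 0 12 (T - t)) +
    flatker 0 0 12 t * (1 * (-1 * flatker 0 1 12 (T - t)))).
  apply (is_derive_mult_R (flatker 0 0 12) (fun t => 1 * flatker 0 0 12 (T - t))).
  - apply is_derive_flatker_t; lra.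
  - apply is_derive_scal.
    apply (is_derive_comp (flatker 0 0 12) (fun t => T - t)).
    + apply is_derive_flatker_t; lra.
    + auto_derive; [trivial | ring]. }
set (I := (fun t => RInt (psi O) 0 t) : R -> R).
assert (DI : forall t, is_derive I t (psi O t)).
{ intros t; apply (is_derive_RInt (psi O) I 0 t); [|apply C0].
  apply filter_forall; intros z; apply (RInt_correct (V := R_CompleteNormedModule)).
  apply (ex_RInt_continuous (V := R_CompleteNormedModule)); intros; apply C0. }
assert (I0 : I 0 = 0) by exact (RInt_point 0 (psi O)).
assert (PZ : 0 < I T).
{ apply RInt_gt_0; [exact hT | | intros; apply C0].
  intros t ht; change (0 < flatker 0 0 12 t * (1 * flatker 0 0 12 (T - t))); cbn [flatker].
  destruct (Rlt_dec 0 t); [|lra]; destruct (Rlt_dec 0 (T - t)); [|lra].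
  pose proof (Rmult_lt_0_compat _ _ (exp_pos (- (12 / t)))
    (exp_pos (- (12 / (T - t))))); simpl; lra. }
set (Z := I T) in *.
pose proof (Rinv_0_lt_compat Z PZ) as PZ'.
set (phi := fun q t => match q with O => 1 - / Z * I t | S r => - / Z * psi r t end).
assert (K0 : forall q, flatker 0 q 12 0 = 0) by (intros; apply flatker_nonpos; lra).
exists (1 + T * / Z + 2 * / Z), phi; split; [nra|]; split; [|split; [|split; [|split]]].
- intros [|q] t ht; simpl.
  + apply is_derive_on_is_derive; [exact ht|].
    replace (- / Z * psi O t) with (0 - / Z * psi O t) by ring.
    apply (is_derive_minus (V := R_NormedModule) (fun _ => 1) (fun t => / Z * I t)).
    * apply (is_derive_const (V := R_NormedModule) 1).
    * apply is_derive_scal, DI.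
  + apply is_derive_on_scal; [exact ht | apply HT; exact ht].
- simpl; rewrite I0; ring.
- intros q; simpl; unfold psi; rewrite binsum_zero; [ring|].
  intros k l _; rewrite K0; ring.
- intros [|q]; simpl; [fold Z; field; lra|].
  unfold psi; rewrite binsum_zero; [ring|].
  intros k l _; rewrite Rminus_diag, K0; ring.
- intros [|q] t ht.
  + simpl (facR _); simpl (2 ^ 0); simpl.
    assert (HI : Rabs (I t - I 0) <= 1 * Rabs (t - 0)).
    { apply (lipschitz_on 0 T 1 I (psi O)); try lra.
      - intros u hu; apply is_derive_on_is_derive; [exact hu | apply DI].
      - intros u hu; pose proof (HB O u) as H; simpl in H; simpl; lra. }
    rewrite I0, !Rminus_0_r, (Rabs_pos_eq t) in HI by lra.
    unfold Rminus; eapply Rle_trans; [apply Rabs_triang|].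
    rewrite Rabs_R1, Rabs_Ropp, Rabs_mult, (Rabs_pos_eq (/ Z)) by lra.
    assert (/ Z * Rabs (I t) <= / Z * T) by (apply Rmult_le_compat_l; lra).
    lra.
  + simpl phi; rewrite Rabs_mult, Rabs_Ropp, (Rabs_pos_eq (/ Z)) by lra.
    pose proof (HB q t) as H; pose proof (pow_lt 2 q ltac:(lra)).
    pose proof (facR_pos (2 * q + 1)) as F.
    replace (2 * S q)%nat with (S (2 * q + 1)) by lia.
    rewrite facR_S; simpl (2 ^ S q).
    apply (Rmult_le_compat_l (/ Z)) in H; [|lra].
    eapply Rle_trans; [exact H|].
    replace (/ Z * (facR (2 * q + 1) / 2 ^ q)) with
      ((2 * / Z) * (1 * facR (2 * q + 1)) / (2 * 2 ^ q)) by (field; split; lra).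
    unfold Rdiv; apply Rmult_le_compat_r; [left; apply Rinv_0_lt_compat; lra|].
    apply Rmult_le_compat; [lra | lra | nra |].
    apply Rmult_le_compat_r; [lra | pose proof (pos_INR (2 * q + 1)); lra].
Qed.

(** The factor [2 q + 1] is absorbed by lowering the rate from [2] to [3 / 2]. *)
Lemma gevrey_rate_loss (q : nat) :
  facR (2 * q + 1) / 2 ^ q <= 6 * facR (2 * q) / (3 / 2) ^ q.
Proof.
replace (2 * q + 1)%nat with (S (2 * q)) by lia; rewrite facR_S, mult_INR; simpl (INR 2).
pose proof (pow_lt (3 / 2) q ltac:(lra)); pose proof (facR_pos (2 * q)).
pose proof (poly q (1 / 3) ltac:(lra)) as HB; pose proof (pos_INR q).
replace (2 ^ q) with ((3 / 2) ^ q * (1 + 1 / 3) ^ q).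
2:{ rewrite <- Rpow_mult_distr; f_equal; field. }
apply (Rmult_le_reg_r ((3 / 2) ^ q * (1 + 1 / 3) ^ q)).
- apply Rmult_lt_0_compat; lra.
- field_simplify; try lra; nra.
Qed.

(** Multiplication by the cutoff keeps the jet at [0] and cancels the one at
    [T]. *)
Lemma gevrey_jet_one_end (kap T : R) : 0 < kap -> 12 * kap < 1 -> 0 < T ->
  exists K, 0 < K /\ forall (C : R) (d : nat -> R), 0 <= C ->
  (forall p, Rabs (d p) <= C * (facR p * facR p) * kap ^ p) ->
  exists f, tower 0 T f /\ (forall q, f q 0 = d q) /\ (forall q, f q T = 0) /\
    forall q t, 0 <= t <= T -> Rabs (f q t) <= K * C * facR (2 * q) / (3 / 2) ^ q.
Proof.
intros hk hk1 hT.
destruct (borel_gevrey kap hk hk1) as [K1 [hK1 HB]].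
destruct (gevrey_cutoff T hT) as [K2 [phi [hK2 [TP [P0 [P1 [P2 BP]]]]]]].
exists (K2 * K1 * 6); split; [repeat apply Rmult_lt_0_compat; lra|].
intros C d hC Hd.
destruct (HB T C d hT hC Hd) as [g [TG [G0 BG]]].
exists (fun q t => binsum q (fun k l => phi k t * g l t)).
split; [|split; [|split]].
- apply tower_mult; assumption.
- intros q; rewrite binsum_left; [rewrite P0, G0; ring|].
  intros k l; rewrite P1; ring.
- intros q; apply binsum_zero; intros k l _; rewrite P2; ring.
- intros q t ht.
  eapply Rle_trans; [apply (binsum_gevrey_bound (fun k => phi k t) (fun k => g k t)
    K2 (K1 * C)); intros k; auto|].
  pose proof (gevrey_rate_loss q) as HL.
  apply (Rmult_le_compat_l (K2 * (K1 * C))) in HL.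
  + unfold Rdiv in *; lra.
  + repeat apply Rmult_le_pos; lra.
Qed.

(** Jets at both ends: the second one is the first one with time reversed. *)
Lemma gevrey_jet_two_ends (kap T : R) : 0 < kap -> 12 * kap < 1 -> 0 < T ->
  exists K, 0 < K /\ forall (C : R) (d e : nat -> R), 0 <= C ->
  (forall p, Rabs (d p) <= C * (facR p * facR p) * kap ^ p) ->
  (forall p, Rabs (e p) <= C * (facR p * facR p) * kap ^ p) ->
  exists f, tower 0 T f /\ (forall q, f q 0 = d q) /\ (forall q, f q T = e q) /\
    forall q t, 0 <= t <= T -> Rabs (f q t) <= K * C * facR (2 * q) / (3 / 2) ^ q.
Proof.
intros hk hk1 hT.
destruct (gevrey_jet_one_end kap T hk hk1 hT) as [K [hK HK]].
exists (2 * K); split; [lra|]; intros C d e hC Hd He.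
destruct (HK C d hC Hd) as [f [Tf [f0 [f1 Bf]]]].
destruct (HK C (fun q => (-1) ^ q * e q) hC) as [g [Tg [g0 [g1 Bg]]]].
{ intros p; rewrite Rabs_mult, pow_1_abs, Rmult_1_l; apply He. }
exists (fun q t => f q t + (-1) ^ q * g q (T - t)); split; [|split; [|split]].
- apply tower_plus; [exact Tf | apply tower_reflect; exact Tg].
- intros q; rewrite Rminus_0_r, f0, g1; ring.
- intros q; rewrite Rminus_diag, f1, g0, <- Rmult_assoc, <- Rpow_mult_distr.
  replace (-1 * -1) with 1 by ring; rewrite pow1; ring.
- intros q t ht; eapply Rle_trans; [apply Rabs_triang|].
  rewrite Rabs_mult, pow_1_abs, Rmult_1_l.
  pose proof (Bf q t ht); pose proof (Bg q (T - t) ltac:(lra)); unfold Rdiv in *; lra.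
Qed.

(** * The two Taylor recursions *)

(** Recursion on the first index of a double sequence, with access to all the
    smaller indices: [rec_tab Phi n] is correct below [n]. *)
Fixpoint rec_tab (Phi : (nat -> nat -> R) -> nat -> nat -> R) (n : nat) :
  nat -> nat -> R :=
  match n with
  | O => fun _ _ => 0
  | S m => fun k p =>
      if Nat.eq_dec k m then Phi (rec_tab Phi m) m p else rec_tab Phi m k p
  end.

Definition rec_seq Phi (k p : nat) : R := rec_tab Phi (S k) k p.

Lemma rec_tab_seq Phi n k p :
  (k < n)%nat -> rec_tab Phi n k p = rec_seq Phi k p.
Proof.
induction n as [|n IH]; intros h; [lia|].
destruct (Nat.eq_dec k n) as [E|E]; [subst; reflexivity|].
simpl; destruct (Nat.eq_dec k n); [lia|]; apply IH; lia.
Qed.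

Lemma rec_seq_eq Phi n p :
  (forall u v, (forall k q, (k < n)%nat -> u k q = v k q) -> Phi u n p = Phi v n p) ->
  rec_seq Phi n p = Phi (rec_seq Phi) n p.
Proof.
intros H; unfold rec_seq at 1; simpl.
destruct (Nat.eq_dec n n) as [_|]; [|lia].
apply H; intros k q hk; apply rec_tab_seq, hk.
Qed.

(** [u n p] stands for the derivative of order [n] in [x] and [p] in [t] of a
    function at [x = 0], and [square_jet u n p] for that of its square. *)
Definition square_jet (u : nat -> nat -> R) (n p : nat) : R :=
  binsum n (fun k l => binsum p (fun q q' => u k q * u l q')).

Lemma square_jet_ext (u v : nat -> nat -> R) (n p : nat) :
  (forall k q, (k <= n)%nat -> (q <= p)%nat -> u k q = v k q) ->
  square_jet u n p = square_jet v n p.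
Proof.
intros H; apply binsum_ext; intros k l E; apply binsum_ext; intros q q' E'.
rewrite !H by lia; reflexivity.
Qed.

(** The equation, solved for the time derivatives at [t = 0]. Here the first
    index of [c] is the order in time. *)
Definition time_step (sgn : R) (al be : nat -> R) (c : nat -> nat -> R)
  (p n : nat) : R :=
  match p with
  | O => al n
  | S O => be n
  | S (S r) => sgn * c r (n + 4)%nat + c r (n + 2)%nat
               - square_jet (fun k q => c q k) (n + 2) r
  end.

Definition time_jet sgn al be : nat -> nat -> R := rec_seq (time_step sgn al be).

Lemma time_jet_eq sgn al be p n :
  time_jet sgn al be p n = time_step sgn al be (time_jet sgn al be) p n.
Proof.
apply rec_seq_eq; intros u v H; destruct p as [|[|p]]; simpl; trivial.
rewrite !H by lia; f_equal.
apply square_jet_ext; intros; apply H; lia.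
Qed.

Lemma time_jet_S sgn al be p n :
  time_jet sgn al be (S (S p)) n =
  sgn * time_jet sgn al be p (n + 4) + time_jet sgn al be p (n + 2)
  - square_jet (fun k q => time_jet sgn al be q k) (n + 2) p.
Proof. apply time_jet_eq. Qed.

(** The equation, solved for the space derivatives at [x = 0] of an even
    function; [g] and [h] are the jets in time of [y] and of its second space
    derivative. *)
Definition space_step (sgn : R) (g h : nat -> R) (a : nat -> nat -> R)
  (n p : nat) : R :=
  match n with
  | O => g p
  | S O => 0
  | S (S O) => h p
  | S (S (S O)) => 0
  | S (S (S (S m))) =>
      sgn * (a m (p + 2)%nat - a (m + 2)%nat p + square_jet a (m + 2) p)
  end.

Definition space_jet sgn g h : nat -> nat -> R := rec_seq (space_step sgn g h).

Lemma space_jet_eq sgn g h n p :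
  space_jet sgn g h n p = space_step sgn g h (space_jet sgn g h) n p.
Proof.
apply rec_seq_eq; intros u v H; destruct n as [|[|[|[|n]]]]; simpl; trivial.
rewrite !H by lia; do 2 f_equal.
apply square_jet_ext; intros; apply H; lia.
Qed.

Lemma space_jet_S sgn g h n p :
  space_jet sgn g h (S (S (S (S n)))) p =
  sgn * (space_jet sgn g h n (p + 2) - space_jet sgn g h (n + 2) p
         + square_jet (space_jet sgn g h) (n + 2) p).
Proof. apply space_jet_eq. Qed.

(** * Majorants *)

(** The three terms on the right of the equation, in either direction, compared
    with [(m + 4)!]: the lower order and the nonlinear term gain the factors
    [1 / 12] and [1 / 4]. *)
Lemma three_terms_le (m : nat) (W a b c d : R) : 0 <= W -> 0 <= b -> 0 <= c ->
  a + b / 12 + c / 4 <= d ->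
  a * (W * facR (m + 4)) + b * (W * facR (m + 2)) + c * (W * facR (m + 3)) <=
  d * (W * facR (m + 4)).
Proof.
intros hW hb hc H.
replace (m + 4)%nat with (S (S (m + 2))) by lia.
replace (m + 3)%nat with (S (m + 2)) by lia.
rewrite !facR_S, S_INR, plus_INR; simpl (INR 2).
pose proof (facR_pos (m + 2)); pose proof (pos_INR m).
set (V := W * facR (m + 2)).
assert (hV : 0 <= V) by (apply Rmult_le_pos; lra).
set (N := (INR m + (1 + 1) + 1 + 1) * (INR m + (1 + 1) + 1)).
assert (B1 : 12 <= N) by (unfold N; nra).
assert (B2 : 4 * (INR m + (1 + 1) + 1) <= N) by (unfold N; nra).
replace (W * ((INR m + (1 + 1) + 1 + 1) * ((INR m + (1 + 1) + 1) * facR (m + 2))))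
  with (N * V) by (unfold N, V; ring).
replace (W * ((INR m + (1 + 1) + 1) * facR (m + 2))) with
  ((INR m + (1 + 1) + 1) * V) by (unfold V; ring).
apply Rle_trans with ((a + b / 12 + c / 4) * N * V).
- replace (a * (N * V) + b * V + c * ((INR m + (1 + 1) + 1) * V)) with
    ((a * N + b + c * (INR m + (1 + 1) + 1)) * V) by ring.
  apply Rmult_le_compat_r; [exact hV | nra].
- rewrite <- (Rmult_assoc d); apply Rmult_le_compat_r; [exact hV|].
  apply Rmult_le_compat_r; lra.
Qed.

(** The constants: [16] is a lower bound of the radius of the data, and [50]
    satisfies [50 ^ 2 * (1 / 16 ^ 4 + 1 / (12 * 16 ^ 2)) < 1], which leaves room
    for the nonlinear term when [C] is small. The factor [50] between the
    hypotheses and the conclusion serves the first time derivative. *)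
Lemma time_jet_bound (sgn C : R) (al be : nat -> R) :
  sgn = 1 \/ sgn = -1 -> 0 <= C -> C <= 1 / 20 ->
  (forall n, Rabs (al n) <= C / 50 * facR n / 16 ^ n) ->
  (forall n, Rabs (be n) <= C / 50 * facR n / 16 ^ n) ->
  forall p n, Rabs (time_jet sgn al be p n) <= C * facR (n + 2 * p) / (16 ^ n * 50 ^ p).
Proof.
intros hs hC hC' Hal Hbe.
assert (As : Rabs sgn = 1).
{ destruct hs; subst; [apply Rabs_R1 | rewrite Rabs_left; lra]. }
apply (well_founded_ind lt_wf (fun p => forall n, Rabs (time_jet sgn al be p n) <=
  C * facR (n + 2 * p) / (16 ^ n * 50 ^ p))).
intros p IH n; pose proof (pow_lt 16 n ltac:(lra)) as P16.
destruct p as [|[|p]].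
- rewrite time_jet_eq; simpl time_step; simpl (50 ^ 0).
  replace (n + 2 * 0)%nat with n by lia; rewrite Rmult_1_r.
  eapply Rle_trans; [apply Hal|]; pose proof (facR_pos n).
  unfold Rdiv; apply Rmult_le_compat_r; [left; apply Rinv_0_lt_compat, P16|].
  apply Rmult_le_compat_r; lra.
- rewrite time_jet_eq; simpl time_step; simpl (50 ^ 1).
  eapply Rle_trans; [apply Hbe|]; pose proof (facR_pos n).
  assert (F : facR n <= facR (n + 2 * 1)).
  { pose proof (facR_mult_le n (2 * 1)) as F; simpl (facR (2 * 1)) in F; lra. }
  replace (C / 50 * facR n / 16 ^ n) with (C / (16 ^ n * (50 * 1)) * facR n)
    by (field; lra).
  replace (C * facR (n + 2 * 1) / (16 ^ n * (50 * 1))) with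
    (C / (16 ^ n * (50 * 1)) * facR (n + 2 * 1)) by (field; lra).
  apply Rmult_le_compat_l; [|exact F].
  apply Rmult_le_pos; [exact hC | left; apply Rinv_0_lt_compat; lra].
- rewrite time_jet_S.
  pose proof (IH p ltac:(lia) (n + 4)%nat) as H1.
  pose proof (IH p ltac:(lia) (n + 2)%nat) as H2.
  assert (B : forall k q, (k <= n + 2)%nat -> (q <= p)%nat ->
    Rabs (time_jet sgn al be q k) <= C * facR (k + 2 * q) / (16 ^ k * 50 ^ q)).
  { intros k q _ hq; apply IH; lia. }
  pose proof (leibniz_bound (fun k q => time_jet sgn al be q k)
    (fun k q => time_jet sgn al be q k) C C 16 50 (n + 2) p
    ltac:(lra) ltac:(lra) B B) as H3.
  eapply Rle_trans.
  { unfold Rminus; eapply Rle_trans; [apply Rabs_triang|].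
    apply Rplus_le_compat; [eapply Rle_trans; [apply Rabs_triang|];
      apply Rplus_le_compat|].
    - rewrite Rabs_mult, As, Rmult_1_l; exact H1.
    - exact H2.
    - rewrite Rabs_Ropp; exact H3. }
  pose proof (pow_lt 50 p ltac:(lra)) as P50.
  replace (n + 4 + 2 * p)%nat with (n + 2 * p + 4)%nat by lia.
  replace (n + 2 + 2 * p)%nat with (n + 2 * p + 2)%nat by lia.
  replace (n + 2 * p + 2 + 1)%nat with (n + 2 * p + 3)%nat by lia.
  replace (n + 2 * S (S p))%nat with (n + 2 * p + 4)%nat by lia.
  pose proof (three_terms_le (n + 2 * p) (C / (16 ^ n * 50 ^ p))
    (1 / 65536) (1 / 256) (C / 256) (1 / 2500)) as H.
  assert (0 <= C / (16 ^ n * 50 ^ p)).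
  { apply Rmult_le_pos; [exact hC | left; apply Rinv_0_lt_compat].
    apply Rmult_lt_0_compat; assumption. }
  specialize (H ltac:(assumption) ltac:(lra) ltac:(lra) ltac:(lra)).
  rewrite !pow_add; simpl (50 ^ S (S p)).
  eapply Rle_trans; [|eapply Rle_trans; [exact H|]]; right; field; lra.
Qed.

(** With [x ^ 2 = 121 / 100] and [r = 3 / 2] one has
    [x ^ 4 / r ^ 2 + x ^ 2 / 12 < 1], and [x = 11 / 10] exceeds the length of the
    space interval. *)
Lemma space_jet_bound (sgn C : R) (g h : nat -> R) :
  sgn = 1 \/ sgn = -1 -> 0 <= C -> C <= 1 / 2 ->
  (forall p, Rabs (g p) <= C / 2 * facR (2 * p) / (3 / 2) ^ p) ->
  (forall p, Rabs (h p) <= C / 2 * facR (2 * p) / (3 / 2) ^ p) ->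
  forall n p, Rabs (space_jet sgn g h n p) <=
    C * facR (n + 2 * p) / ((11 / 10) ^ n * (3 / 2) ^ p).
Proof.
intros hs hC hC' Hg Hh.
assert (As : Rabs sgn = 1).
{ destruct hs; subst; [apply Rabs_R1 | rewrite Rabs_left; lra]. }
apply (well_founded_ind lt_wf (fun n => forall p, Rabs (space_jet sgn g h n p) <=
  C * facR (n + 2 * p) / ((11 / 10) ^ n * (3 / 2) ^ p))).
intros n IH p; pose proof (pow_lt (3 / 2) p ltac:(lra)) as Pr.
pose proof (Rinv_0_lt_compat _ Pr) as Pr'.
assert (PZ : forall k, 0 <= C * facR (k + 2 * p) / ((11 / 10) ^ k * (3 / 2) ^ p)).
{ intros k; apply Rmult_le_pos.
  - apply Rmult_le_pos; [exact hC | left; apply facR_pos].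
  - left; apply Rinv_0_lt_compat, Rmult_lt_0_compat; [apply pow_lt; lra | exact Pr]. }
destruct n as [|[|[|[|n]]]].
- rewrite space_jet_eq; simpl space_step; simpl ((11 / 10) ^ 0).
  rewrite Nat.add_0_l, Rmult_1_l; eapply Rle_trans; [apply Hg|].
  pose proof (facR_pos (2 * p)).
  unfold Rdiv; apply Rmult_le_compat_r; [lra|]; apply Rmult_le_compat_r; lra.
- rewrite space_jet_eq; simpl space_step; rewrite Rabs_R0; apply PZ.
- rewrite space_jet_eq; simpl space_step; simpl ((11 / 10) ^ 2).
  eapply Rle_trans; [apply Hh|].
  pose proof (facR_pos (2 * p)).
  assert (F : facR (2 * p) <= facR (2 + 2 * p)).
  { pose proof (facR_mult_le 2 (2 * p)) as F; simpl (facR 2) in F; lra. }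
  replace (C / 2 * facR (2 * p) / (3 / 2) ^ p) with
    (C * (/ (3 / 2) ^ p) * (facR (2 * p) / 2)) by (field; lra).
  replace (C * facR (2 + 2 * p) / (11 / 10 * (11 / 10 * 1) * (3 / 2) ^ p)) with
    (C * (/ (3 / 2) ^ p) * (facR (2 + 2 * p) * (100 / 121))) by (field; lra).
  apply Rmult_le_compat_l; [apply Rmult_le_pos; lra | lra].
- rewrite space_jet_eq; simpl space_step; rewrite Rabs_R0; apply PZ.
- rewrite space_jet_S.
  pose proof (IH n ltac:(lia) (p + 2)%nat) as H1.
  pose proof (IH (n + 2)%nat ltac:(lia) p) as H2.
  assert (B : forall k q, (k <= n + 2)%nat -> (q <= p)%nat ->
    Rabs (space_jet sgn g h k q) <=
    C * facR (k + 2 * q) / ((11 / 10) ^ k * (3 / 2) ^ q)).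
  { intros k q hk _; apply IH; lia. }
  pose proof (leibniz_bound (space_jet sgn g h) (space_jet sgn g h) C C
    (11 / 10) (3 / 2) (n + 2) p ltac:(lra) ltac:(lra) B B) as H3.
  rewrite Rabs_mult, As, Rmult_1_l.
  eapply Rle_trans.
  { eapply Rle_trans; [apply Rabs_triang|].
    apply Rplus_le_compat; [unfold Rminus; eapply Rle_trans; [apply Rabs_triang|];
      apply Rplus_le_compat|].
    - exact H1.
    - rewrite Rabs_Ropp; exact H2.
    - exact H3. }
  pose proof (pow_lt (11 / 10) n ltac:(lra)) as Px.
  replace (n + 2 * (p + 2))%nat with (n + 2 * p + 4)%nat by lia.
  replace (n + 2 + 2 * p)%nat with (n + 2 * p + 2)%nat by lia.
  replace (n + 2 * p + 2 + 1)%nat with (n + 2 * p + 3)%nat by lia.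
  replace (S (S (S (S n))) + 2 * p)%nat with (n + 2 * p + 4)%nat by lia.
  pose proof (three_terms_le (n + 2 * p) (C / ((11 / 10) ^ n * (3 / 2) ^ p))
    (4 / 9) (100 / 121) (100 / 121 * C) (10000 / 14641)) as H.
  assert (0 <= C / ((11 / 10) ^ n * (3 / 2) ^ p)).
  { apply Rmult_le_pos; [exact hC | left; apply Rinv_0_lt_compat].
    apply Rmult_lt_0_compat; assumption. }
  specialize (H ltac:(assumption) ltac:(lra) ltac:(lra) ltac:(lra)).
  rewrite !pow_add; simpl ((11 / 10) ^ S (S (S (S n)))).
  eapply Rle_trans; [|eapply Rle_trans; [exact H|]]; right; field; lra.
Qed.

(** This is [C(2 p, p) <= 4 ^ p], with [4] replaced by [4.15] to absorb the
    polynomial factor [(2 p + 1) (2 p + 2)]. *)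
Lemma facR_double_le (p : nat) :
  facR (2 * p + 2) <= 14400 * (facR p * facR p) * (415 / 100) ^ p.
Proof.
assert (H4 : facR (2 * p + 2) <= 4 * (INR p + 1) ^ 2 * (facR p * facR p) * 4 ^ p).
{ induction p as [|p IH]; [simpl; lra|].
  replace (2 * S p + 2)%nat with (S (S (2 * p + 2))) by lia.
  rewrite !facR_S, !S_INR, plus_INR, mult_INR; simpl (INR 2).
  pose proof (pos_INR p); pose proof (facR_pos p); pose proof (pow_lt 4 p ltac:(lra)).
  pose proof (facR_pos (2 * p + 2)).
  simpl (4 ^ S p).
  replace (4 * (INR p + 1 + 1) ^ 2 * ((INR p + 1) * facR p * ((INR p + 1) * facR p)) *
    (4 * 4 ^ p)) with (4 * (INR p + 2) ^ 2 *
    (4 * (INR p + 1) ^ 2 * (facR p * facR p) * 4 ^ p)) by ring.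
  rewrite <- Rmult_assoc; apply Rmult_le_compat; nra. }
eapply Rle_trans; [exact H4|].
pose proof (poly p (1 / 60) ltac:(lra)) as HB; pose proof (pos_INR p).
assert (HP : (INR p + 1) ^ 2 <= 3600 * (415 / 400) ^ p).
{ apply Rle_trans with (3600 * ((1 + 1 / 60) ^ p * (1 + 1 / 60) ^ p)).
  - apply Rle_trans with (3600 * ((1 + INR p * (1 / 60)) * (1 + INR p * (1 / 60)))); [nra|].
    apply Rmult_le_compat_l; [lra|]; apply Rmult_le_compat; nra.
  - apply Rmult_le_compat_l; [lra|]; rewrite <- Rpow_mult_distr; apply pow_incr; lra. }
pose proof (facR_pos p); pose proof (pow_lt 4 p ltac:(lra)).
replace (415 / 100) with (415 / 400 * 4) by field; rewrite Rpow_mult_distr.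
replace (4 * (INR p + 1) ^ 2 * (facR p * facR p) * 4 ^ p) with
  ((INR p + 1) ^ 2 * (4 * (facR p * facR p) * 4 ^ p)) by ring.
replace (14400 * (facR p * facR p) * ((415 / 400) ^ p * 4 ^ p)) with
  (3600 * (415 / 400) ^ p * (4 * (facR p * facR p) * 4 ^ p)) by ring.
apply Rmult_le_compat_r; [|exact HP].
apply Rmult_le_pos; [apply Rmult_le_pos; nra | lra].
Qed.

(** The rate [83 / 1000 = 4.15 / 50] is less than [1 / 12], as Borel's theorem
    requires. *)
Lemma time_jet_at_0_bound (C : R) (c : nat -> nat -> R) : 0 <= C ->
  (forall p n, Rabs (c p n) <= C * facR (n + 2 * p) / (16 ^ n * 50 ^ p)) ->
  forall p n, (n <= 2)%nat ->
  Rabs (c p n) <= C * 14400 * (facR p * facR p) * (83 / 1000) ^ p.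
Proof.
intros hC H p n hn; eapply Rle_trans; [apply H|].
pose proof (pow_lt 50 p ltac:(lra)); pose proof (pow_lt 16 n ltac:(lra)).
assert (F : facR (n + 2 * p) <= facR (2 * p + 2)).
{ pose proof (facR_mult_le (n + 2 * p) (2 - n)) as F.
  pose proof (facR_ge_1 (2 - n)); pose proof (facR_pos (n + 2 * p)).
  replace (n + 2 * p + (2 - n))%nat with (2 * p + 2)%nat in F by lia; nra. }
pose proof (facR_double_le p) as F2.
assert (P16 : 1 <= 16 ^ n) by (apply pow_R1_Rle; lra).
apply (Rmult_le_reg_r (16 ^ n * 50 ^ p)); [apply Rmult_lt_0_compat; assumption|].
replace (C * facR (n + 2 * p) / (16 ^ n * 50 ^ p) * (16 ^ n * 50 ^ p)) with
  (C * facR (n + 2 * p)) by (field; lra).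
replace (C * 14400 * (facR p * facR p) * (83 / 1000) ^ p * (16 ^ n * 50 ^ p)) with
  (C * (14400 * (facR p * facR p) * (415 / 100) ^ p) * 16 ^ n).
2:{ replace (415 / 100) with (83 / 1000 * 50) by field.
    rewrite Rpow_mult_distr; ring. }
apply Rle_trans with (C * (14400 * (facR p * facR p) * (415 / 100) ^ p) * 1).
- rewrite Rmult_1_r; apply Rmult_le_compat_l; lra.
- apply Rmult_le_compat_l; [|exact P16].
  apply Rmult_le_pos; [exact hC|]; pose proof (facR_pos (2 * p + 2)); lra.
Qed.

(** In the convolution of a square, one of two indices with odd sum is odd. *)
Lemma time_jet_odd (sgn : R) (al be : nat -> R) :
  (forall n, al (2 * n + 1)%nat = 0) -> (forall n, be (2 * n + 1)%nat = 0) ->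
  forall p n, time_jet sgn al be p (2 * n + 1) = 0.
Proof.
intros Hal Hbe.
apply (well_founded_ind lt_wf (fun p => forall n, time_jet sgn al be p (2 * n + 1) = 0)).
intros p IH n; destruct p as [|[|p]].
- rewrite time_jet_eq; apply Hal.
- rewrite time_jet_eq; apply Hbe.
- rewrite time_jet_S.
  replace (2 * n + 1 + 4)%nat with (2 * (n + 2) + 1)%nat by lia.
  rewrite IH by lia.
  replace (2 * n + 1 + 2)%nat with (2 * (n + 1) + 1)%nat by lia.
  rewrite IH by lia.
  unfold square_jet; rewrite binsum_zero; [ring|].
  intros k l E; apply binsum_zero; intros q q' Eq.
  destruct (Nat.Even_or_Odd k) as [[j Ej]|[j Ej]].
  + replace l with (2 * (n + 1 - j) + 1)%nat by lia; rewrite IH by lia; ring.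
  + subst k; rewrite IH by lia; ring.
Qed.

(** Both recursions express the same equation, so the space jet that starts
    from two rows of a time jet reproduces all of it. *)
Lemma space_jet_time_jet (sgn : R) (al be g h : nat -> R) :
  sgn = 1 \/ sgn = -1 ->
  (forall n, al (2 * n + 1)%nat = 0) -> (forall n, be (2 * n + 1)%nat = 0) ->
  (forall p, g p = time_jet sgn al be p 0) ->
  (forall p, h p = time_jet sgn al be p 2) ->
  forall n p, space_jet sgn g h n p = time_jet sgn al be p n.
Proof.
intros hs Hal Hbe Hg Hh.
pose proof (time_jet_odd sgn al be Hal Hbe) as Hodd.
apply (well_founded_ind lt_wf (fun n => forall p, space_jet sgn g h n p = time_jet sgn al be p n)).
intros n IH p; destruct n as [|[|[|[|n]]]].
- rewrite space_jet_eq; apply Hg.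
- rewrite space_jet_eq; symmetry; apply (Hodd p O).
- rewrite space_jet_eq; apply Hh.
- rewrite space_jet_eq; symmetry; apply (Hodd p 1%nat).
- rewrite space_jet_S, !IH by lia.
  replace (p + 2)%nat with (S (S p)) by lia; rewrite time_jet_S.
  rewrite (square_jet_ext (space_jet sgn g h) (fun k q => time_jet sgn al be q k))
    by (intros; apply IH; lia).
  replace (S (S (S (S n)))) with (n + 4)%nat by lia.
  destruct hs; subst; ring.
Qed.

Lemma tower_space_jet (sgn a b : R) (g h : nat -> R -> R) :
  tower a b g -> tower a b h ->
  forall n, tower a b (fun p t => space_jet sgn (fun q => g q t) (fun q => h q t) n p).
Proof.
intros Tg Th.
set (u := fun n p t => space_jet sgn (fun q => g q t) (fun q => h q t) n p).
apply (well_founded_ind lt_wf (fun n => tower a b (u n))); intros n IH.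
assert (T0 : tower a b (fun _ _ => 0)).
{ intros p t ht; apply is_derive_on_is_derive; [exact ht|].
  apply (is_derive_const (V := R_NormedModule) 0). }
destruct n as [|[|[|[|n]]]];
  [apply (tower_ext a b g); [|exact Tg] | apply (tower_ext a b (fun _ _ => 0)); [|exact T0]
  | apply (tower_ext a b h); [|exact Th] | apply (tower_ext a b (fun _ _ => 0)); [|exact T0]
  | apply (tower_ext a b (fun p t => sgn * (u n (p + 2)%nat t + (-1) * u (n + 2)%nat p t
      + binsum (n + 2) (fun k l => if andb (Nat.leb k (n + 2)) (Nat.leb l (n + 2))
          then binsum p (fun q q' => u k q t * u l q' t) else 0))))];
  try (intros; symmetry; apply space_jet_eq).
- intros p t ht; transitivity (sgn * (u n (p + 2)%nat t + (-1) * u (n + 2)%nat p t +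
    square_jet (fun k q => u k q t) (n + 2) p)).
  + f_equal; f_equal; apply binsum_ext; intros k l E.
    destruct (Nat.leb_spec k (n + 2)); [|lia].
    destruct (Nat.leb_spec l (n + 2)); [|lia]; reflexivity.
  + unfold u; rewrite space_jet_S; unfold square_jet; ring.
- (* The summands outside the range of the convolution are set to zero because the
     induction hypothesis says nothing on them. *)
  apply tower_scal, tower_plus; [apply tower_plus|].
  + apply (tower_shift a b (u n)), IH; lia.
  + apply tower_scal, IH; lia.
  + apply (tower_binsum a b (fun k l p t => if andb (Nat.leb k (n + 2)) (Nat.leb l (n + 2))
      then binsum p (fun q q' => u k q t * u l q' t) else 0)).
    intros k l.
    destruct (Nat.leb_spec k (n + 2)); [|exact T0].
    destruct (Nat.leb_spec l (n + 2)); [|exact T0].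
    apply (tower_mult a b (u k) (u l)); apply IH; lia.
Qed.

(** * Smooth functions of two variables *)

Definition tower2 (x1 x2 t1 t2 : R) (Y : nat -> nat -> R -> R -> R) : Prop :=
  (forall p t, t1 <= t <= t2 -> tower x1 x2 (fun k x => Y k p x t)) /\
  (forall k x, x1 <= x <= x2 -> tower t1 t2 (fun p t => Y k p x t)).

Lemma tower2_Dx (x1 x2 t1 t2 : R) (Y : nat -> nat -> R -> R -> R)
  (y : R -> R -> R) (k p : nat) :
  x1 < x2 -> tower2 x1 x2 t1 t2 Y ->
  (forall x t, x1 <= x <= x2 -> t1 <= t <= t2 -> y x t = Y k p x t) ->
  forall j x t, x1 <= x <= x2 -> t1 <= t <= t2 ->
  Dx_n x1 x2 j y x t = Y (j + k)%nat p x t.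
Proof.
intros hx [H _] E j x t hxx htt; unfold Dx_n.
apply (tower_Derive_n_on x1 x2 (fun j x => Y (j + k)%nat p x t)); auto.
intros q z hz; apply (H p t htt (q + k)%nat z hz).
Qed.

Lemma tower2_Dt (x1 x2 t1 t2 : R) (Y : nat -> nat -> R -> R -> R)
  (y : R -> R -> R) (k p : nat) :
  t1 < t2 -> tower2 x1 x2 t1 t2 Y ->
  (forall x t, x1 <= x <= x2 -> t1 <= t <= t2 -> y x t = Y k p x t) ->
  forall j x t, x1 <= x <= x2 -> t1 <= t <= t2 ->
  Dt_n t1 t2 j y x t = Y k (j + p)%nat x t.
Proof.
intros hx [_ H] E j x t hxx htt; unfold Dt_n.
apply (tower_Derive_n_on t1 t2 (fun j t => Y k (j + p)%nat x t)); auto.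
intros q z hz; apply (H k x hxx (q + p)%nat z hz).
Qed.

(** Bounds on the two first derivatives give a Lipschitz constant, hence joint
    continuity. *)
Lemma tower2_continuous_on (x1 x2 t1 t2 : R) (Y : nat -> nat -> R -> R -> R)
  (M : nat -> nat -> R) (y : R -> R -> R) (k p : nat) :
  tower2 x1 x2 t1 t2 Y ->
  (forall k p x t, x1 <= x <= x2 -> t1 <= t <= t2 -> Rabs (Y k p x t) <= M k p) ->
  (forall x t, x1 <= x <= x2 -> t1 <= t <= t2 -> y x t = Y k p x t) ->
  continuous_on (fun q : R * R => x1 <= fst q <= x2 /\ t1 <= snd q <= t2)
    (fun q : R * R => y (fst q) (snd q)).
Proof.
intros [Hx Ht] HB E [x t] [hx ht]; simpl in hx, ht.
apply filterlim_locally; intros eps; simpl.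
pose proof (Rle_trans _ _ _ (Rabs_pos _) (HB (S k) p x t hx ht)) as P1.
pose proof (Rle_trans _ _ _ (Rabs_pos _) (HB k (S p) x t hx ht)) as P2.
set (N := M (S k) p + M k (S p) + 1).
assert (hd : 0 < eps / N) by (apply Rdiv_lt_0_compat; [apply cond_pos | unfold N; lra]).
exists (mkposreal _ hd); intros [x' t'] [Bx Bt] [hx' ht']; simpl in *.
assert (Bx' : Rabs (x' - x) < eps / N) by exact Bx.
assert (Bt' : Rabs (t' - t) < eps / N) by exact Bt.
change (Rabs (y x' t' - y x t) < eps); rewrite !E by assumption.
replace (Y k p x' t' - Y k p x t) with
  ((Y k p x' t' - Y k p x t') + (Y k p x t' - Y k p x t)) by ring.
eapply Rle_lt_trans; [apply Rabs_triang|].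
assert (L1 : Rabs (Y k p x' t' - Y k p x t') <= M (S k) p * Rabs (x' - x)).
{ apply (lipschitz_on x1 x2 _ (fun x => Y k p x t') (fun x => Y (S k) p x t')); auto.
  intros u hu; apply (Hx p t' ht' k u hu). }
assert (L2 : Rabs (Y k p x t' - Y k p x t) <= M k (S p) * Rabs (t' - t)).
{ apply (lipschitz_on t1 t2 _ (fun t => Y k p x t) (fun t => Y k (S p) x t)); auto.
  intros u hu; apply (Ht k x hx p u hu). }
apply Rle_lt_trans with (M (S k) p * (eps / N) + M k (S p) * (eps / N)).
- apply Rplus_le_compat; eapply Rle_trans; try eassumption;
    apply Rmult_le_compat_l; lra.
- apply Rlt_le_trans with (N * (eps / N)).
  + rewrite <- Rmult_plus_distr_r; apply Rmult_lt_compat_r; [exact hd | unfold N; lra].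
  + right; field; unfold N; lra.
Qed.

Lemma tower2_smooth_on2 (x1 x2 t1 t2 : R) (Y : nat -> nat -> R -> R -> R)
  (M : nat -> nat -> R) :
  x1 < x2 -> t1 < t2 -> tower2 x1 x2 t1 t2 Y ->
  (forall k p x t, x1 <= x <= x2 -> t1 <= t <= t2 -> Rabs (Y k p x t) <= M k p) ->
  forall n (y : R -> R -> R) k p,
  (forall x t, x1 <= x <= x2 -> t1 <= t <= t2 -> y x t = Y k p x t) ->
  C_n_on2 x1 x2 t1 t2 n y.
Proof.
intros hx ht HY HB; induction n as [|n IH]; intros y k p E; simpl.
- split; [|trivial]; apply (tower2_continuous_on x1 x2 t1 t2 Y M y k p); assumption.
- split; [apply (tower2_continuous_on x1 x2 t1 t2 Y M y k p); assumption|].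
  split; [|split].
  + intros x t hxx htt; destruct HY as [Hx Ht]; split.
    * exists (Y (S k) p x t); apply (is_derive_on_ext x1 x2 (fun x => Y k p x t)); auto.
      -- intros z hz; symmetry; auto.
      -- apply (Hx p t htt k x hxx).
    * exists (Y k (S p) x t); apply (is_derive_on_ext t1 t2 (fun t => Y k p x t)); auto.
      -- intros z hz; symmetry; auto.
      -- apply (Ht k x hxx p t htt).
  + apply (IH _ (S k) p); apply (tower2_Dx x1 x2 t1 t2 Y y k p hx HY E 1).
  + apply (IH _ k (S p)); apply (tower2_Dt x1 x2 t1 t2 Y y k p ht HY E 1).
Qed.

(** * The solution as a power series in space *)

(** [a n p] is the derivative of order [p] of the coefficient [a n 0]. The
    radius of convergence [11 / 10] leaves room for the factorials that
    differentiation produces. *)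
Definition coef_jet (T C : R) (a : nat -> nat -> R -> R) : Prop :=
  (forall n, tower 0 T (a n)) /\
  forall n p t, 0 <= t <= T ->
    Rabs (a n p t) <= C * facR (n + 2 * p) / ((11 / 10) ^ n * (3 / 2) ^ p).

Definition coef (a : nat -> nat -> R -> R) (k p : nat) (t : R) (n : nat) : R :=
  a (n + k)%nat p t / facR n.

Definition sol (a : nat -> nat -> R -> R) (k p : nat) (x t : R) : R :=
  PSeries (coef a k p t) x.

(** Binomial coefficients [C(n + N, N)] are at most
    [(21 / 20) ^ n * 21 ^ N], and [21 / 20 * 10 / 11 = 21 / 22 < 1]. *)
Definition coef_size (C : R) (k p : nat) : R :=
  C * facR (k + 2 * p) * 21 ^ (k + 2 * p) / ((11 / 10) ^ k * (3 / 2) ^ p).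

Lemma coef_bound (T C : R) (a : nat -> nat -> R -> R) : 0 <= C -> coef_jet T C a ->
  forall k p t n, 0 <= t <= T ->
  Rabs (coef a k p t n) <= coef_size C k p * (21 / 22) ^ n.
Proof.
intros hC [_ HB] k p t n ht; unfold coef, coef_size.
pose proof (facR_pos n) as Pn.
unfold Rdiv at 1; rewrite Rabs_mult, (Rabs_pos_eq (/ facR n))
  by (left; apply Rinv_0_lt_compat, Pn).
apply (Rmult_le_reg_r (facR n)); [exact Pn|].
rewrite Rmult_assoc, Rinv_l, Rmult_1_r by lra.
eapply Rle_trans; [apply HB, ht|].
pose proof (binomial_term_le (20 / 21) (1 / 21) ltac:(lra) ltac:(lra) ltac:(lra)
  n (k + 2 * p)) as H.
replace (n + k + 2 * p)%nat with (n + (k + 2 * p))%nat by lia.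
set (N := (k + 2 * p)%nat) in *; set (F := facR (n + N)) in *.
pose proof (pow_lt (11 / 10) n ltac:(lra)) as A1.
pose proof (pow_lt (11 / 10) k ltac:(lra)) as A2.
pose proof (pow_lt (3 / 2) p ltac:(lra)) as A3.
pose proof (pow_lt 21 N ltac:(lra)) as A4.
pose proof (pow_lt (20 / 21) n ltac:(lra)) as A5.
rewrite (pow_add _ n k).
replace ((1 / 21) ^ N) with (/ 21 ^ N) in H.
2:{ rewrite <- pow_inv; f_equal; field. }
replace ((21 / 22) ^ n) with (/ ((20 / 21) ^ n * (11 / 10) ^ n)).
2:{ rewrite <- Rpow_mult_distr, <- pow_inv; f_equal; field. }
replace (C * F / ((11 / 10) ^ n * (11 / 10) ^ k * (3 / 2) ^ p)) with
  (C * 21 ^ N / ((20 / 21) ^ n * (11 / 10) ^ n * (11 / 10) ^ k * (3 / 2) ^ p) *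
   (F * (20 / 21) ^ n * / 21 ^ N)) by (field; repeat split; lra).
replace (C * facR N * 21 ^ N / ((11 / 10) ^ k * (3 / 2) ^ p) *
  / ((20 / 21) ^ n * (11 / 10) ^ n) * facR n) with
  (C * 21 ^ N / ((20 / 21) ^ n * (11 / 10) ^ n * (11 / 10) ^ k * (3 / 2) ^ p) *
   (facR n * facR N)) by (field; repeat split; lra).
apply Rmult_le_compat_l; [|exact H].
apply Rmult_le_pos; [apply Rmult_le_pos; lra|].
left; apply Rinv_0_lt_compat; repeat apply Rmult_lt_0_compat; assumption.
Qed.

Lemma CV_radius_gt_1 (u : nat -> R) (B x : R) :
  (forall n, Rabs (u n) <= B * (21 / 22) ^ n) -> Rabs x <= 1 ->
  Rbar_lt (Rabs x) (CV_radius u).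
Proof.
intros H hx.
apply Rbar_lt_le_trans with (22 / 21); [simpl; lra|].
apply (CV_radius_bounded u); exists B; intros n.
rewrite Rabs_mult, (Rabs_pos_eq ((22 / 21) ^ n)) by (apply pow_le; lra).
apply Rle_trans with (B * (21 / 22) ^ n * (22 / 21) ^ n).
- apply Rmult_le_compat_r; [apply pow_le; lra | apply H].
- right; rewrite Rmult_assoc, <- Rpow_mult_distr.
  replace (21 / 22 * (22 / 21)) with 1 by field; rewrite pow1; ring.
Qed.

Lemma coef_CV_radius (T C : R) (a : nat -> nat -> R -> R) : 0 <= C -> coef_jet T C a ->
  forall k p t x, 0 <= t <= T -> Rabs x <= 1 ->
  Rbar_lt (Rabs x) (CV_radius (coef a k p t)).
Proof.
intros hC Ha k p t x ht hx; apply (CV_radius_gt_1 _ (coef_size C k p)); [|exact hx].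
intros n; apply (coef_bound T C); assumption.
Qed.

Lemma ex_series_21_22 (B : R) : ex_series (fun n => B * (21 / 22) ^ n).
Proof.
apply (ex_series_scal_l (K := R_AbsRing) B (fun n => (21 / 22) ^ n)).
apply ex_series_geom; rewrite Rabs_pos_eq; lra.
Qed.

Lemma term_bound (B u x : R) (n : nat) :
  Rabs u <= B -> Rabs x <= 1 -> Rabs (u * x ^ n) <= B.
Proof.
intros hu hx; rewrite Rabs_mult, <- RPow_abs.
assert (Rabs x ^ n <= 1).
{ rewrite <- (pow1 n); apply pow_incr; split; [apply Rabs_pos | exact hx]. }
pose proof (pow_le _ n (Rabs_pos x)); pose proof (Rabs_pos u); nra.
Qed.

Lemma sol_bound (T C : R) (a : nat -> nat -> R -> R) : 0 <= C -> coef_jet T C a ->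
  forall k p x t, 0 <= x <= 1 -> 0 <= t <= T ->
  Rabs (sol a k p x t) <= 22 * coef_size C k p.
Proof.
intros hC Ha k p x t hx ht.
replace (22 * coef_size C k p) with
  (Series (fun n => coef_size C k p * (21 / 22) ^ n)).
2:{ rewrite Series_scal_l, Series_geom by (rewrite Rabs_pos_eq; lra); field. }
apply Series_bounded; [|apply ex_series_21_22].
intros n; apply term_bound; [|rewrite Rabs_pos_eq; lra].
apply (coef_bound T C); assumption.
Qed.

Lemma sol_tower2 (T C : R) (a : nat -> nat -> R -> R) : 0 <= C -> coef_jet T C a ->
  tower2 0 1 0 T (sol a).
Proof.
intros hC Ha; split.
- intros p t ht k x hx; apply is_derive_on_is_derive; [exact hx|].
  unfold sol; rewrite <- (PSeries_ext (PS_derive (coef a k p t))).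
  + apply is_derive_PSeries, (coef_CV_radius T C); try assumption.
    rewrite Rabs_pos_eq; lra.
  + intros n; unfold PS_derive, coef; replace (S n + k)%nat with (n + S k)%nat by lia.
    rewrite facR_S, S_INR; pose proof (pos_INR n); pose proof (facR_neq n).
    field; split; [assumption | lra].
- intros k x hx.
  apply (tower_Series 0 T (fun n q t => coef a k q t n * x ^ n)
    (fun q n => coef_size C k q * (21 / 22) ^ n)).
  + intros n q t ht; unfold coef.
    apply (is_derive_on_ext 0 T (fun t => (x ^ n / facR n) * a (n + k)%nat q t));
      [exact ht | intros; unfold Rdiv; ring |].
    replace (a (n + k)%nat (S q) t / facR n * x ^ n) with
      ((x ^ n / facR n) * a (n + k)%nat (S q) t) by (unfold Rdiv; ring).
    apply is_derive_on_scal; [exact ht | apply Ha; exact ht].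
  + intros n q t ht; apply term_bound; [|rewrite Rabs_pos_eq; lra].
    apply (coef_bound T C); assumption.
  + intros q; apply ex_series_21_22.
Qed.

(** Splitting the factorial of [k + 2 p] costs powers of [2] only, which gives
    Gevrey order [1] in [x] and [2] in [t]. *)
Lemma coef_size_le (C : R) (k p : nat) : 0 <= C ->
  coef_size C k p <=
  C * facR k * (facR p * facR p) / ((1 / 42) ^ k * (1 / 7056) ^ p).
Proof.
intros hC; unfold coef_size.
assert (D : forall i j, facR (i + j) <= facR i * facR j * 2 ^ (i + j)).
{ intros i j.
  pose proof (binomial_term_le (1 / 2) (1 / 2) ltac:(lra) ltac:(lra) ltac:(lra) i j) as H.
  rewrite Rmult_assoc, <- pow_add in H.
  replace ((1 / 2) ^ (i + j)) with (/ 2 ^ (i + j)) in H.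
  2:{ rewrite <- pow_inv; f_equal; field. }
  pose proof (pow_lt 2 (i + j) ltac:(lra)) as P2.
  apply (Rmult_le_compat_r (2 ^ (i + j))) in H; [|lra].
  rewrite Rmult_assoc, Rinv_l, Rmult_1_r in H by lra; exact H. }
pose proof (D k (2 * p)%nat) as H1; pose proof (D p p) as H2.
replace (p + p)%nat with (2 * p)%nat in H2 by lia.
pose proof (facR_pos k) as Pk; pose proof (facR_pos p) as Pp.
pose proof (pow_lt 2 (k + 2 * p) ltac:(lra)) as Q1.
pose proof (pow_lt 21 (k + 2 * p) ltac:(lra)) as Q2.
assert (H3 : facR (k + 2 * p) <=
  facR k * (facR p * facR p) * (2 ^ (2 * p) * 2 ^ (k + 2 * p))).
{ eapply Rle_trans; [exact H1|].
  apply Rle_trans with (facR k * (facR p * facR p * 2 ^ (2 * p)) * 2 ^ (k + 2 * p)).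
  - apply Rmult_le_compat_r; [lra|]; apply Rmult_le_compat_l; lra.
  - right; ring. }
assert (I1 : 1 <= (11 / 10) ^ k) by (apply pow_R1_Rle; lra).
assert (I2 : 1 <= (3 / 2) ^ p) by (apply pow_R1_Rle; lra).
apply Rle_trans with (C * facR (k + 2 * p) * 21 ^ (k + 2 * p)).
{ pose proof (facR_pos (k + 2 * p)).
  apply (Rmult_le_reg_r ((11 / 10) ^ k * (3 / 2) ^ p)); [nra|].
  unfold Rdiv; rewrite Rmult_assoc, Rinv_l, Rmult_1_r by nra.
  rewrite <- (Rmult_1_r (C * _ * _)) at 1; apply Rmult_le_compat_l; [|nra].
  apply Rmult_le_pos; [apply Rmult_le_pos|]; lra. }
apply Rle_trans with (C * (facR k * (facR p * facR p) *
  (2 ^ (2 * p) * 2 ^ (k + 2 * p))) * 21 ^ (k + 2 * p)).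
{ apply Rmult_le_compat_r; [lra|]; apply Rmult_le_compat_l; assumption. }
right.
replace ((1 / 42) ^ k) with (/ (2 ^ k * 21 ^ k)).
2:{ rewrite <- Rpow_mult_distr, <- pow_inv; f_equal; field. }
replace ((1 / 7056) ^ p) with (/ (2 ^ (2 * p) * 2 ^ (2 * p) * 21 ^ (2 * p))).
2:{ rewrite !pow_mult, <- !Rpow_mult_distr, <- pow_inv; f_equal; field. }
rewrite !(pow_add _ k).
pose proof (pow_nonzero 2 k ltac:(lra)); pose proof (pow_nonzero 21 k ltac:(lra)).
pose proof (pow_nonzero 2 (2 * p) ltac:(lra)); pose proof (pow_nonzero 21 (2 * p) ltac:(lra)).
field; repeat split; assumption.
Qed.

Lemma Rpower_2 (z : R) : 0 < z -> Rpower z 2 = z * z.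
Proof.
intros hz; replace 2 with (INR 2) by (simpl; ring); rewrite Rpower_pow by exact hz.
simpl; ring.
Qed.

Lemma sol_Gevrey2 (T C : R) (a : nat -> nat -> R -> R) : 0 < T -> 0 <= C ->
  coef_jet T C a -> Gevrey2 1 2 0 1 0 T (sol a 0 0).
Proof.
intros hT hC Ha; pose proof (sol_tower2 T C a hC Ha) as HT2; split.
- intros n; apply (tower2_smooth_on2 0 1 0 T (sol a) (fun k p => 22 * coef_size C k p)
    ltac:(lra) hT HT2 (sol_bound T C a hC Ha) n _ 0 0); reflexivity.
- exists (22 * (C + 1)), (1 / 42), (1 / 7056).
  split; [lra|]; split; [lra|]; split; [lra|]; intros p1 p2 x t hx ht.
  rewrite (tower2_Dx 0 1 0 T (sol a) _ 0 p2 ltac:(lra) HT2) by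
    (try assumption; intros x' t' hx' ht';
     rewrite (tower2_Dt 0 1 0 T (sol a) _ 0 0 hT HT2) by (try assumption; reflexivity);
     rewrite Nat.add_0_r; reflexivity).
  rewrite Nat.add_0_r, Rpower_1, Rpower_2 by apply facR_pos.
  eapply Rle_trans; [apply (sol_bound T C a hC Ha); assumption|].
  eapply Rle_trans; [apply Rmult_le_compat_l; [lra | apply coef_size_le, hC]|].
  pose proof (facR_pos p1); pose proof (facR_pos p2).
  pose proof (pow_lt (1 / 42) p1 ltac:(lra)); pose proof (pow_lt (1 / 7056) p2 ltac:(lra)).
  unfold Rdiv; rewrite <- Rmult_assoc.
  apply Rmult_le_compat_r.
  + left; apply Rinv_0_lt_compat, Rmult_lt_0_compat; assumption.
  + rewrite (Rmult_assoc (22 * (C + 1))), <- !(Rmult_assoc 22), (Rmult_assoc (22 * C)).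
    apply Rmult_le_compat_r; [|lra].
    left; repeat apply Rmult_lt_0_compat; assumption.
Qed.

Lemma sol_Gevrey_trace (T C : R) (a : nat -> nat -> R -> R) (k : nat) : 0 < T -> 0 <= C ->
  coef_jet T C a -> Gevrey 2 0 T (sol a k 0 1).
Proof.
intros hT hC Ha; destruct (sol_tower2 T C a hC Ha) as [_ Ht].
pose proof (Ht k 1 ltac:(lra)) as H; split.
- apply (tower_smooth_on 0 T (fun p t => sol a k p 1 t)); trivial.
- assert (Q : 0 < (1 / 42) ^ k) by (apply pow_lt; lra).
  pose proof (facR_pos k) as Pk.
  exists (22 * (C + 1) * facR k / (1 / 42) ^ k), (1 / 7056).
  split; [apply Rdiv_lt_0_compat; [apply Rmult_lt_0_compat; lra | exact Q]|].
  split; [lra|]; intros p t ht.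
  rewrite (tower_Derive_n_on 0 T (fun p t => sol a k p 1 t)) by trivial.
  rewrite Rpower_2 by apply facR_pos.
  eapply Rle_trans; [apply (sol_bound T C a hC Ha); lra|].
  eapply Rle_trans; [apply Rmult_le_compat_l; [lra | apply coef_size_le, hC]|].
  pose proof (facR_pos p) as Pp; pose proof (pow_lt (1 / 7056) p ltac:(lra)) as Q'.
  replace (22 * (C * facR k * (facR p * facR p) / ((1 / 42) ^ k * (1 / 7056) ^ p))) with
    (22 * C * (facR k * (facR p * facR p) / ((1 / 42) ^ k * (1 / 7056) ^ p)))
    by (unfold Rdiv; ring).
  replace (22 * (C + 1) * facR k / (1 / 42) ^ k * (facR p * facR p) / (1 / 7056) ^ p) with
    (22 * (C + 1) * (facR k * (facR p * facR p) / ((1 / 42) ^ k * (1 / 7056) ^ p)))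
    by (field; lra).
  apply Rmult_le_compat_r; [|lra].
  left; apply Rdiv_lt_0_compat; repeat apply Rmult_lt_0_compat; assumption.
Qed.

Lemma sol_at_x_0 (a : nat -> nat -> R -> R) (k p : nat) (t : R) :
  sol a k p 0 t = a k p t.
Proof.
unfold sol; rewrite PSeries_0; unfold coef; simpl; field.
Qed.

Lemma sol_square_xx (T C : R) (a : nat -> nat -> R -> R) (x t : R) :
  0 <= C -> coef_jet T C a -> 0 <= x <= 1 -> 0 <= t <= T ->
  let v := fun n => square_jet (fun k q => a k q t) (n + 2) 0 / facR n in
  ex_pseries v x /\
  binsum 2 (fun k l => sol a k 0 x t * sol a l 0 x t) = PSeries v x.
Proof.
intros hC Ha hx ht v.
assert (R1 : forall k, Rbar_lt (Rabs x) (CV_radius (coef a k 0 t))).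
{ intros k; apply (coef_CV_radius T C); try assumption; rewrite Rabs_pos_eq; lra. }
set (m := fun k l => PS_mult (coef a k 0 t) (coef a l 0 t)).
assert (X : forall k l, ex_pseries (m k l) x) by (intros; apply ex_pseries_mult; auto).
assert (E : forall k l, sol a k 0 x t * sol a l 0 x t = PSeries (m k l) x).
{ intros k l; unfold m; rewrite PSeries_mult by auto; reflexivity. }
set (w := PS_plus (PS_plus (m 2%nat 0%nat) (m 1%nat 1%nat))
  (PS_plus (m 1%nat 1%nat) (m 0%nat 2%nat))).
assert (Ew : forall n, w n = v n).
{ intros n; unfold w, v, m, PS_plus, coef.
  rewrite !(PS_mult_binsum (fun n => a (n + _)%nat 0%nat t)
    (fun n => a (n + _)%nat 0%nat t)).
  unfold square_jet; replace (n + 2)%nat with (S (S n)) by lia.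
  cbn [binsum]; unfold plus; simpl AbelianMonoid.plus.
  rewrite <- !Rdiv_plus_distr; f_equal; f_equal; f_equal;
  apply binsum_ext; intros k l _; f_equal; f_equal; lia. }
assert (Xw : ex_pseries w x).
{ apply (ex_pseries_plus (K := R_AbsRing) (V := R_NormedModule));
  apply (ex_pseries_plus (K := R_AbsRing) (V := R_NormedModule)); apply X. }
split.
- apply (ex_pseries_ext w); assumption.
- rewrite <- (PSeries_ext w v x Ew); unfold w; cbn [binsum]; rewrite !E.
  rewrite (PSeries_plus (PS_plus _ _) (PS_plus _ _)) by
    (apply (ex_pseries_plus (K := R_AbsRing) (V := R_NormedModule)); apply X).
  rewrite (PSeries_plus (m 2%nat 0%nat)), (PSeries_plus (m 1%nat 1%nat)) by apply X.
  reflexivity.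
Qed.

(** The recursion for [a], multiplied by [sgn], equates the Taylor coefficients
    of both sides of the equation. *)
Lemma sol_equation (T C sgn : R) (a : nat -> nat -> R -> R) :
  0 < T -> 0 <= C -> sgn = 1 \/ sgn = -1 -> coef_jet T C a ->
  (forall n p t, a (S (S (S (S n)))) p t = sgn * (a n (p + 2)%nat t - a (n + 2)%nat p t
     + square_jet (fun k q => a k q t) (n + 2) p)) ->
  forall x t, 0 <= x <= 1 -> 0 <= t <= T ->
  Dt_n 0 T 2 (sol a 0 0) x t =
    sgn * Dx_n 0 1 4 (sol a 0 0) x t + Dx_n 0 1 2 (sol a 0 0) x t
    - Dx_n 0 1 2 (fun x' t' => sol a 0 0 x' t' ^ 2) x t.
Proof.
intros hT hC hs Ha Hrec x t hx ht; pose proof (sol_tower2 T C a hC Ha) as HT2.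
rewrite (tower2_Dt 0 1 0 T (sol a) _ 0 0 hT HT2) by (try assumption; reflexivity).
rewrite !(tower2_Dx 0 1 0 T (sol a) (sol a 0 0) 0 0 ltac:(lra) HT2)
  by (try assumption; reflexivity).
assert (Hsq : Dx_n 0 1 2 (fun x' t' => sol a 0 0 x' t' ^ 2) x t =
  binsum 2 (fun k l => sol a k 0 x t * sol a l 0 x t)).
{ destruct HT2 as [Hx _].
  apply (tower_Derive_n_on 0 1
    (fun q z => binsum q (fun k l => sol a k 0 z t * sol a l 0 z t))); try lra.
  - apply (tower_mult 0 1 (fun k z => sol a k 0 z t) (fun k z => sol a k 0 z t));
      apply (Hx 0%nat t ht).
  - intros z _; simpl; ring. }
rewrite Hsq.
destruct (sol_square_xx T C a x t hC Ha hx ht) as [Xv Ev]; rewrite Ev.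
set (v := fun n => square_jet (fun k q => a k q t) (n + 2) 0 / facR n) in *.
simpl (_ + 0)%nat; unfold sol.
assert (X : forall k p, ex_pseries (coef a k p t) x).
{ intros k p; apply CV_radius_inside, (coef_CV_radius T C); try assumption.
  rewrite Rabs_pos_eq; lra. }
rewrite <- (PSeries_scal sgn (coef a 4 0 t)).
assert (X4 : ex_pseries (PS_scal sgn (coef a 4 0 t)) x).
{ apply (ex_pseries_scal (K := R_AbsRing) (V := R_NormedModule)); [apply Rmult_comm | apply X]. }
rewrite <- PSeries_plus by auto.
rewrite <- PSeries_minus.
2:{ apply (ex_pseries_plus (K := R_AbsRing) (V := R_NormedModule)); auto. }
2:{ exact Xv. }
apply PSeries_ext; intros n.
unfold PS_minus, PS_plus, PS_scal, coef, v, plus, opp, scal; simpl; unfold mult; simpl.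
replace (n + 4)%nat with (S (S (S (S n)))) by lia; rewrite Hrec, Nat.add_0_r.
simpl (0 + 2)%nat.
pose proof (facR_neq n); destruct hs; subst; field; assumption.
Qed.

(** * The initial and final data *)

(** For an even sum, changing the signs of the odd coefficients gives another
    expansion of the same function. *)
Lemma is_pseries_zero_odd (al : nat -> R) (z : R -> R) (B : R) :
  (forall n, Rabs (al n) <= B * facR n / 16 ^ n) ->
  (forall x, -1 <= x <= 1 -> is_pseries (fun n => al n / facR n) x (z x)) ->
  (forall x, -1 <= x <= 1 -> z (- x) = z x) ->
  forall n, al (2 * n + 1)%nat = 0.
Proof.
intros HB Hz He n.
set (u := fun n => al n / facR n).
set (w := fun n => (-1) ^ n * u n).
assert (R1 : forall v : nat -> R, (forall n, Rabs (v n) <= B / 16 ^ n) ->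
  Rbar_lt 0 (CV_radius v)).
{ intros v Hv; apply Rbar_lt_le_trans with 1; [simpl; lra|].
  apply (CV_radius_bounded v); exists B; intros k; rewrite pow1, Rmult_1_r.
  eapply Rle_trans; [apply Hv|].
  assert (P1 : 1 <= 16 ^ k) by (apply pow_R1_Rle; lra).
  assert (HB0 : 0 <= B).
  { pose proof (Hv O) as H0; simpl in H0; pose proof (Rabs_pos (v O)); lra. }
  apply (Rmult_le_reg_r (16 ^ k)); [lra|].
  unfold Rdiv; rewrite Rmult_assoc, Rinv_l by lra; nra. }
assert (Bu : forall k, Rabs (u k) <= B / 16 ^ k).
{ intros k; unfold u, Rdiv; pose proof (facR_pos k) as Pk.
  rewrite Rabs_mult, (Rabs_pos_eq (/ facR k)) by (left; apply Rinv_0_lt_compat, Pk).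
  apply (Rmult_le_reg_r (facR k)); [exact Pk|].
  rewrite Rmult_assoc, Rinv_l, Rmult_1_r by lra.
  eapply Rle_trans; [apply HB|]; right; unfold Rdiv; ring. }
assert (E : u (2 * n + 1)%nat = w (2 * n + 1)%nat).
{ apply PSeries_ext_recip; [apply R1, Bu| |].
  - apply R1; intros k; unfold w; rewrite Rabs_mult, pow_1_abs, Rmult_1_l; apply Bu.
  - exists (mkposreal 1 Rlt_0_1); intros x Hx.
    assert (Hx' : Rabs (x - 0) < 1) by exact Hx.
    apply Rabs_def2 in Hx'.
    transitivity (z x); [apply is_pseries_unique, Hz; lra|].
    rewrite <- He by lra; symmetry.
    transitivity (PSeries u (- x)); [|apply is_pseries_unique, Hz; lra].
    apply Series_ext; intros k; unfold w.
    replace (- x) with (-1 * x) by ring; rewrite Rpow_mult_distr; ring. }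
unfold w in E; rewrite Nat.add_1_r, pow_1_odd in E.
unfold u in E; rewrite Nat.add_1_r.
pose proof (facR_pos (S (2 * n))) as P.
assert (E' : al (S (2 * n)) / facR (S (2 * n)) = 0) by lra.
replace (al (S (2 * n))) with (al (S (2 * n)) / facR (S (2 * n)) * facR (S (2 * n)))
  by (field; lra).
rewrite E'; ring.
Qed.

Lemma R_hat_ge_16 : 16 <= R_hat.
Proof.
unfold R_hat.
assert (H : 0 < / (2 * exp 1)).
{ apply Rinv_0_lt_compat; pose proof (exp_pos 1); lra. }
pose proof (exp_ineq1 (/ (2 * exp 1)) ltac:(lra)); lra.
Qed.

Lemma class_R_jet (rho B : R) (z : R -> R) : R_hat < rho -> 0 < B -> class_R rho B z ->
  even_on_unit z ->
  exists al : nat -> R, (forall n, Rabs (al n) <= B * facR n / 16 ^ n) /\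
    (forall n, al (2 * n + 1)%nat = 0) /\
    forall x, 0 <= x <= 1 -> PSeries (fun n => al n / facR n) x = z x.
Proof.
intros hrho hB [al [HB Hz]] He; exists al.
assert (HB' : forall n, Rabs (al n) <= B * facR n / 16 ^ n).
{ intros n; eapply Rle_trans; [apply HB|].
  pose proof (facR_pos n); pose proof R_hat_ge_16.
  apply Rmult_le_compat_l; [nra|]; apply Rinv_le_contravar; [apply pow_lt; lra|].
  apply pow_incr; lra. }
split; [exact HB'|]; split.
- apply (is_pseries_zero_odd al z B); assumption.
- intros x hx; apply is_pseries_unique, Hz; lra.
Qed.

Theorem theorem2p3 (sgn : R) (hsgn : sgn = 1 \/ sgn = -1)
  (rho : R) (hrho : R_hat < rho) (T : R) (hT : 0 < T) :
  exists C_hat : R, 0 < C_hat /\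
    forall y0 y1 z0 z1 : R -> R,
      class_R rho C_hat y0 -> class_R rho C_hat y1 ->
      class_R rho C_hat z0 -> class_R rho C_hat z1 ->
      even_on_unit y0 -> even_on_unit y1 ->
      even_on_unit z0 -> even_on_unit z1 ->
      exists (y : R -> R -> R) (v w : R -> R),
        Gevrey2 1 2 0 1 0 T y /\ Gevrey 2 0 T v /\ Gevrey 2 0 T w /\
        (forall x t : R, 0 <= x <= 1 -> 0 <= t <= T ->
          Dt_n 0 T 2 y x t =
            sgn * Dx_n 0 1 4 y x t + Dx_n 0 1 2 y x t
            - Dx_n 0 1 2 (fun x' t' => y x' t' ^ 2) x t) /\
        (forall t : R, 0 <= t <= T ->
          Dx_n 0 1 1 y 0 t = 0 /\ Dx_n 0 1 1 y 1 t = v t /\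
          Dx_n 0 1 3 y 0 t = 0 /\ Dx_n 0 1 3 y 1 t = w t) /\
        (forall x : R, 0 <= x <= 1 ->
          y x 0 = y0 x /\ Dt_n 0 T 1 y x 0 = y1 x) /\
        (forall x : R, 0 <= x <= 1 ->
          y x T = z0 x /\ Dt_n 0 T 1 y x T = z1 x).
Proof.
destruct (gevrey_jet_two_ends (83 / 1000) T ltac:(lra) ltac:(lra) hT) as [K [hK HJ]].
(* [C] makes the jets at both ends small enough for the time recursion, and
   their interpolation small enough for the space recursion. *)
set (C := / (20 + 57600 * K)).
assert (hC : 0 < C) by (apply Rinv_0_lt_compat; lra).
assert (hC1 : C <= 1 / 20).
{ unfold C; replace (1 / 20) with (/ 20) by field; apply Rinv_le_contravar; lra. }
set (D := 2 * K * (C * 14400)).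
assert (hD : 0 <= D) by (unfold D; apply Rmult_le_pos; lra).
assert (hD1 : D <= 1 / 2).
{ assert (E : C * (20 + 57600 * K) = 1) by (unfold C; field; lra).
  assert (E' : 57600 * (C * K) <= 1) by lra; unfold D; lra. }
exists (C / 50); split; [lra|].
intros y0 y1 z0 z1 cy0 cy1 cz0 cz1 ey0 ey1 ez0 ez1.
destruct (class_R_jet rho (C / 50) y0 hrho ltac:(lra) cy0 ey0) as [al [Bal [Oal Sal]]].
destruct (class_R_jet rho (C / 50) y1 hrho ltac:(lra) cy1 ey1) as [be [Bbe [Obe Sbe]]].
destruct (class_R_jet rho (C / 50) z0 hrho ltac:(lra) cz0 ez0) as [al' [Bal' [Oal' Sal']]].
destruct (class_R_jet rho (C / 50) z1 hrho ltac:(lra) cz1 ez1) as [be' [Bbe' [Obe' Sbe']]].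
set (c := time_jet sgn al be); set (c' := time_jet sgn al' be').
pose proof (time_jet_at_0_bound C c ltac:(lra)
  (time_jet_bound sgn C al be hsgn ltac:(lra) hC1 Bal Bbe)) as Bc.
pose proof (time_jet_at_0_bound C c' ltac:(lra)
  (time_jet_bound sgn C al' be' hsgn ltac:(lra) hC1 Bal' Bbe')) as Bc'.
destruct (HJ (C * 14400) (fun p => c p 0%nat) (fun p => c' p 0%nat) ltac:(lra)
  (fun p => Bc p 0%nat ltac:(lia)) (fun p => Bc' p 0%nat ltac:(lia)))
  as [g [Tg [g0 [g1 Bg]]]].
destruct (HJ (C * 14400) (fun p => c p 2%nat) (fun p => c' p 2%nat) ltac:(lra)
  (fun p => Bc p 2%nat ltac:(lia)) (fun p => Bc' p 2%nat ltac:(lia)))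
  as [h [Th [h0 [h1 Bh]]]].
set (a := fun n p t => space_jet sgn (fun q => g q t) (fun q => h q t) n p).
assert (Ha : coef_jet T D a).
{ split; [apply tower_space_jet; assumption|].
  intros n p t ht; apply space_jet_bound; try assumption; intros q.
  - replace (D / 2) with (K * (C * 14400)) by (unfold D; field); apply Bg, ht.
  - replace (D / 2) with (K * (C * 14400)) by (unfold D; field); apply Bh, ht. }
pose proof (sol_tower2 T D a hD Ha) as HT2.
assert (A0 : forall n p, a n p 0 = c p n).
{ apply space_jet_time_jet; assumption. }
assert (A1 : forall n p, a n p T = c' p n).
{ apply space_jet_time_jet; assumption. }
exists (sol a 0 0), (sol a 1 0 1), (sol a 3 0 1).
split; [apply (sol_Gevrey2 T D); assumption|].
split; [apply (sol_Gevrey_trace T D); assumption|].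
split; [apply (sol_Gevrey_trace T D); assumption|].
split; [|split; [|split]].
- apply (sol_equation T D); try assumption; intros; apply space_jet_S.
- intros t ht.
  rewrite !(tower2_Dx 0 1 0 T (sol a) (sol a 0 0) 0 0 ltac:(lra) HT2)
    by (try assumption; try reflexivity; lra).
  simpl (_ + 0)%nat; rewrite !sol_at_x_0; unfold a; rewrite !space_jet_eq.
  repeat split; reflexivity.
- intros x hx.
  rewrite (tower2_Dt 0 1 0 T (sol a) _ 0 0 hT HT2) by (try assumption; try reflexivity; lra).
  split.
  + rewrite <- Sal by exact hx; apply PSeries_ext; intros n; unfold coef.
    rewrite A0, !Nat.add_0_r; unfold c; rewrite time_jet_eq; reflexivity.
  + rewrite <- Sbe by exact hx; apply PSeries_ext; intros n; unfold coef.
    rewrite A0, !Nat.add_0_r; unfold c; rewrite time_jet_eq; reflexivity.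
- intros x hx.
  rewrite (tower2_Dt 0 1 0 T (sol a) _ 0 0 hT HT2) by (try assumption; try reflexivity; lra).
  split.
  + rewrite <- Sal' by exact hx; apply PSeries_ext; intros n; unfold coef.
    rewrite A1, !Nat.add_0_r; unfold c'; rewrite time_jet_eq; reflexivity.
  + rewrite <- Sbe' by exact hx; apply PSeries_ext; intros n; unfold coef.
    rewrite A1, !Nat.add_0_r; unfold c'; rewrite time_jet_eq; reflexivity.
Qed.
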